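(* For all fixed real numbers $\alpha_1,\alpha_2>0$, $$br\big(C_{2\lfloor\alpha_1 n\rfloor},C_{2\lfloor\alpha_2 n\rfloor}\big)=(\alpha_1+\alpha_2+o(1))\,n ,$$ where $o(1)\to0$ as $n\to\infty$.
   Context: $C_m$ denotes the cycle of length $m$. For bipartite graphs $B_1,\dots,B_r$ ($r\ge2$), the bipartite Ramsey number $br(B_1,\dots,B_r)$ is the minimum integer $N$ such that every $r$-edge coloring (with colors $1,\dots,r$) of the complete bipartite graph $K_{N,N}$ contains, for some $i\in\{1,\dots,r\}$, a monochromatic subgraph in color $i$ isomorphic to $B_i$. *)

(* Defs.v *)
From HB Require Import structures.
From mathcomp Require Import all_boot all_order all_algebra.
From mathcomp Require Import all_classical all_reals all_analysis.

Set Implicit Arguments.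
Unset Strict Implicit.
Unset Printing Implicit Defensive.

Import Order.TTheory GRing.Theory Num.Theory.
Import numFieldNormedType.Exports.

Record sgraph := SGraph {
  vertex :> finType;
  adj : rel vertex;
  adj_sym : symmetric adj;
  adj_irrefl : irreflexive adj }.

Section Cycle.
Variable m : nat.

(* ordS is the successor modulo m.  This is the cycle of length m for m >= 3;
   for m <= 2 the graph degenerates to a path on m vertices. *)
Definition cycle_adj : rel 'I_m :=
  [rel i j | (i != j) && ((j == ordS i) || (i == ordS j))].

Lemma cycle_adj_sym : symmetric cycle_adj.
Proof. by move=> i j; rewrite /cycle_adj /= eq_sym orbC. Qed.

Lemma cycle_adj_irrefl : irreflexive cycle_adj.
Proof. by move=> i; rewrite /cycle_adj /= eqxx. Qed.

Definition cycle_graph : sgraph := SGraph cycle_adj_sym cycle_adj_irrefl.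

End Cycle.

Section CompleteBipartite.
Variables a b : nat.

Definition complete_bipartite_adj : rel ('I_a + 'I_b)%type := fun x y =>
  match x, y with
  | inl _, inr _ | inr _, inl _ => true
  | _, _ => false
  end.

Lemma complete_bipartite_adj_sym : symmetric complete_bipartite_adj.
Proof. by case=> [?|?] [?|?]. Qed.

Lemma complete_bipartite_adj_irrefl : irreflexive complete_bipartite_adj.
Proof. by case. Qed.

Definition complete_bipartite : sgraph :=
  SGraph complete_bipartite_adj_sym complete_bipartite_adj_irrefl.

End CompleteBipartite.

(* An edge xy is the unordered pair [set x; y], and an r-edge colouring assigns
   a colour to it; the colours of sets that are not edges are never used. *)
Definition edge_coloring (r : nat) (G : sgraph) := {ffun {set G} -> 'I_r}.

Section ColorClass.
Variables (r : nat) (G : sgraph) (c : edge_coloring r G) (i : 'I_r).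

Definition color_adj : rel G := fun x y => adj x y && (c [set x; y]%SET == i).

Lemma color_adj_sym : symmetric color_adj.
Proof. by move=> x y; rewrite /color_adj adj_sym finset.setUC. Qed.

Lemma color_adj_irrefl : irreflexive color_adj.
Proof. by move=> x; rewrite /color_adj adj_irrefl. Qed.

Definition color_class : sgraph := SGraph color_adj_sym color_adj_irrefl.

End ColorClass.

(* G has a (not necessarily induced) subgraph isomorphic to H. *)
Definition contains_copy (G H : sgraph) : Prop :=
  exists f : H -> G, injective f /\ forall x y, adj x y -> adj (f x) (f y).

Definition arrows (r : nat) (G : sgraph) (B : 'I_r -> sgraph) : Prop :=
  forall c : edge_coloring r G,
    exists i : 'I_r, contains_copy (color_class c i) (B i).

Definition is_bipartite_ramsey (r : nat) (B : 'I_r -> sgraph) (N : nat) : Prop :=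
  arrows (complete_bipartite N N) B /\
  forall M : nat, arrows (complete_bipartite M M) B -> (N <= M)%N.

(* The default value 0 is only taken when no K_{N,N} arrows B. *)
Definition br (r : nat) (B : 'I_r -> sgraph) : nat :=
  xget 0%N [set N | is_bipartite_ramsey B N]%classic.

Definition pair_family (B1 B2 : sgraph) : 'I_2 -> sgraph :=
  fun i => if i == ord0 then B1 else B2.

(* Main.v *)
Require Import Defs.
From HB Require Import structures.
From mathcomp Require Import all_boot all_order all_algebra.
From mathcomp Require Import ring lra zify.

(* Łuczak's connected-matching method, with a weak form of Szemerédi's lemma.
   Lower bound: split the left side into parts of sizes [a - 1] and [b - 1] and
   colour an edge by the part of its left end.  Upper bound, for [N] slightly
   larger than [a + b]: partition both sides into boundedly many cells so that
   almost every pair of cells is "dense" (has no sparse large subpair) in one of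
   the two colours.  In the reduced graph of a colour, a component whose blow-up
   has a matching of size [a] yields a closed walk of length [2a] that visits no
   cell too often, and such a walk is embedded greedily as a monochromatic cycle.
   If no component works, König's theorem gives every component of the first
   colour a vertex cover of size at most [a], and every component of the second
   one a cover of size at most [b]; together these covers would cover almost all
   of K_{N,N}, which is impossible. *)

Set Implicit Arguments.
Unset Strict Implicit.
Unset Printing Implicit Defensive.

(** König's theorem is applied to single vertices: the edges are all pairs of kept vertices in
    adjacent cells. This handles cells of different sizes directly, and as matched vertices are
    distinct, the matching part of the walk visits a cell at most as often as it has kept vertices.
    The kept vertices fill at most a fraction [1 - 3 * tau] of each cell. The slack pays for the
    part of the walk that joins the matching edges, for the reserve that closes the cycle, and for
    the free vertices that a greedy embedding always needs. The embedding asks one thing of a pair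
    of cells: large subpairs have density at least 1/4. A pair that fails this in both colours has
    density at least 1/2 in one of them, and yet a large subpair of density below 1/4 in that
    colour. This jump of 1/4 is what a refinement exploits. The parameter of density is
    [eps = tau ^+ 2], so that an [eps] fraction of irregular pairs leaves at most a [tau] fraction
    of vertices with more than a [tau] fraction of irregular partners. *)

(** * König's theorem *)

Definition covers (X Y : finType) (E : {set X * Y}) (S : {set X}) (T : {set Y}) :=
  [forall p in E, (p.1 \in S) || (p.2 \in T)].

(* Lovász's argument: delete edges as long as the cover number stays at least [k].
   In an edge-critical graph two edges sharing a vertex are impossible, because
   the meet and join of covers missing one of them would be too small. *)
Lemma konig (X Y : finType) (E : {set X * Y}) (k : nat) :
    (forall S T, covers E S T -> k <= #|S| + #|T|) ->
  exists M : {set X * Y}, [/\ M \subset E, {in M &, injective fst},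
    {in M &, injective snd} & k <= #|M|].
Proof.
have [n] := ubnP #|E|; elim: n => // n IHn in E * => /ltnSE leEn covE.
have [/existsP[p /andP[pE /forallP /= pcov]]|] :=
  boolP [exists p in E, [forall S, [forall T, covers (E :\ p) S T ==> (k <= #|S| + #|T|)]]].
  have [||M [ME i1 i2 kM]] := IHn (E :\ p).
  - by move: leEn; rewrite (cardsD1 p) pE.
  - by move=> S T; have /forallP/(_ T)/implyP := pcov S.
  by exists M; split=> //; apply: subset_trans ME (subsetDl _ _).
rewrite negb_exists_in => /forall_inP critE.
have crit p : p \in E -> exists (S : {set X}) (T : {set Y}),
    [/\ forall r, r \in E -> r != p -> (r.1 \in S) || (r.2 \in T),
    p.1 \notin S, p.2 \notin T & #|S| + #|T| < k].
  move=> pE; have := critE _ pE; rewrite negb_forall => /existsP[S].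
  rewrite negb_forall => /existsP[T]; rewrite negb_imply -ltnNge => /andP[/forall_inP cST lt].
  have cr r : r \in E -> r != p -> (r.1 \in S) || (r.2 \in T).
    by move=> rE rp; apply: cST; rewrite !inE rp.
  have nc : ~~ covers E S T by apply: contraL lt => /covE; rewrite -leqNgt.
  exists S, T; split=> //; apply: contra nc => pS; apply/forall_inP => q qE;
    by have [->|qp] := eqVneq q p; rewrite ?pS ?orbT ?cr.
(* Two covers of size at most [k - 1] have total size at most [2k - 2], so even with one extra
   vertex the total stays below the [2k] that two covers of [E] need. *)
have ncrit (S S' : {set X}) (T T' : {set Y}) : #|S| + #|T| < k -> #|S'| + #|T'| < k ->
    (forall U V, covers E U V -> k <= #|U| + #|V|) ->
    forall U U' V V', covers E U V -> covers E U' V' ->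
    #|U| + #|U'| + (#|V| + #|V'|) <= (#|S| + #|S'| + (#|T| + #|T'|)).+1 -> False.
  by move=> h1 h2 h3 U U' V V' /h3 h4 /h3 h5; move: h1 h2 h4 h5; clear; lia.
exists E; split=> //.
- move=> p q pE qE eq1; apply/eqP; apply/idPn => npq.
  have [S [T [c1 pS pT lt1]]] := crit p pE; have [S' [T' [c2 qS qT lt2]]] := crit q qE.
  have pT' : p.2 \in T' by have := c2 p pE npq; rewrite eq1 (negPf qS).
  have qT2 : q.2 \in T by have := c1 q qE; rewrite -eq1 (negPf pS) eq_sym; apply.
  apply: (ncrit _ _ _ _ lt1 lt2 covE (S :&: S') (p.1 |: (S :|: S')) (T :|: T') (T :&: T')).
  + apply/forall_inP => r rE; rewrite !inE.
    have [->|rp] := eqVneq r p; first by rewrite pT' !orbT.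
    have [->|rq] := eqVneq r q; first by rewrite qT2 !orbT.
    by case/orP: (c1 r rE rp) => ->; case/orP: (c2 r rE rq) => ->; rewrite ?orbT.
  + apply/forall_inP => r rE; rewrite !inE.
    have [->|rp] := eqVneq r p; first by rewrite eqxx.
    have [->|rq] := eqVneq r q; first by rewrite eq1 eqxx.
    by case/orP: (c1 r rE rp) => ->; case/orP: (c2 r rE rq) => ->; rewrite ?orbT.
  rewrite cardsU1; move: (cardsUI S S') (cardsUI T T') (leq_b1 (p.1 \notin S :|: S')); clear; lia.
- move=> p q pE qE eq1; apply/eqP; apply/idPn => npq.
  have [S [T [c1 pS pT lt1]]] := crit p pE; have [S' [T' [c2 qS qT lt2]]] := crit q qE.
  have pS' : p.1 \in S' by have := c2 p pE npq; rewrite eq1 (negPf qT) orbF.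
  have qS2 : q.1 \in S by have := c1 q qE; rewrite -eq1 (negPf pT) orbF eq_sym; apply.
  apply: (ncrit _ _ _ _ lt1 lt2 covE (S :|: S') (S :&: S') (T :&: T') (p.2 |: (T :|: T'))).
  + apply/forall_inP => r rE; rewrite !inE.
    have [->|rp] := eqVneq r p; first by rewrite pS' !orbT.
    have [->|rq] := eqVneq r q; first by rewrite qS2.
    by case/orP: (c1 r rE rp) => ->; case/orP: (c2 r rE rq) => ->; rewrite ?orbT.
  + apply/forall_inP => r rE; rewrite !inE.
    have [->|rp] := eqVneq r p; first by rewrite eqxx orbT.
    have [->|rq] := eqVneq r q; first by rewrite eq1 eqxx orbT.
    by case/orP: (c1 r rE rp) => ->; case/orP: (c2 r rE rq) => ->; rewrite ?orbT.
  rewrite cardsU1; move: (cardsUI S S') (cardsUI T T') (leq_b1 (p.2 \notin T :|: T')); clear; lia.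
(* [E] is now a matching, and its left ends cover it. *)
have := covE (fst @: E) set0; rewrite cards0 addn0 => h.
apply: leq_trans (h _) (leq_imset_card _ _).
by apply/forall_inP => r rE; rewrite imset_f.
Qed.

(** * Two covers of a complete bipartite graph *)

Section TwoCovers.
Variables (V : finType) (side : V -> bool) (V0 : {set V}).

Definition half s : {set V} := [set v in V0 | side v == s].

(** [f v] and [g v] stand for the components of [v] in the two colours, and [C] and [D] for the
    unions of the covers chosen in these components. *)
Definition covered (T1 T2 : eqType) (f : V -> T1) (g : V -> T2) (C D : {set V}) (v w : V) :=
  (f v == f w) && ((v \in C) || (w \in C)) || (g v == g w) && ((v \in D) || (w \in D)).

Definition uncovered (T1 T2 : eqType) (f : V -> T1) (g : V -> T2) (C D : {set V}) v : {set V} :=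
  [set w in V0 | (side w != side v) && ~~ covered f g C D v w].

Lemma pick_half s (P : {set V}) :
  #|P| < #|half s| -> exists v, [/\ v \in V0, side v = s & v \notin P].
Proof.
move=> lt; have /subsetPn[v] : ~~ (half s \subset P).
  by apply: contraL lt => /subset_leq_card; rewrite leqNgt.
by rewrite inE => /andP[? /eqP ?]; exists v.
Qed.

Section Cover.
Variables (T1 T2 : eqType) (f : V -> T1) (g : V -> T2) (C D : {set V}) (a b beta : nat).

Definition cover_at (T : eqType) (h : V -> T) (E : {set V}) t : {set V} := [set v in E | h v == t].

Hypothesis cardC : forall t, #|cover_at f C t| <= a.
Hypothesis cardD : forall t, #|cover_at g D t| <= b.
Hypothesis card_unc : forall v, v \in V0 -> #|uncovered f g C D v| <= beta.
Hypothesis card_half : forall s, a + b + 2 * beta < #|half s|.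

(** A vertex outside both covers relies on the other end of each pair: every opposite vertex would
    be uncovered with it, or lie in the [C]-cover of [f v] or in the [D]-cover of [g v], and these
    are too few. *)
Lemma cover_all v : v \in V0 -> (v \in C) || (v \in D).
Proof.
move=> vV; apply/norP => -[vC vD].
have [|w [wV sw]] := @pick_half (~~ side v)
    (uncovered f g C D v :|: (cover_at f C (f v) :|: cover_at g D (g v))).
  apply: leq_trans (card_half _); rewrite ltnS.
  rewrite !cardsU; move: (cardC (f v)) (cardD (g v)) (card_unc vV); clear; lia.
rewrite !inE wV sw /covered (negPf vC) (negPf vD) /= [f w == _]eq_sym [g w == _]eq_sym.
by case: (side v) (f v == f w) (g v == g w) (w \in C) (w \in D) => -[] [] [] [].
Qed.

(** By [cover_all], the vertices of the side outside [P] would all lie in the [C]-cover of [x] or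
    the [D]-cover of [y], which have at most [a + b] elements together. *)
Lemma no_single_type s (x : T1) (y : T2) (P : {set V}) : #|P| <= 2 * beta ->
  (forall v, v \in V0 -> side v = s -> v \notin P -> f v = x /\ g v = y) -> False.
Proof.
move=> cP typ; have [|v [vV sv]] := @pick_half s (P :|: (cover_at f C x :|: cover_at g D y)).
  apply: leq_trans (card_half _); rewrite ltnS !cardsU; move: cP (cardC x) (cardD y); clear; lia.
rewrite !inE => /norP[/(typ v vV sv)[-> ->]]; rewrite !eqxx !andbT.
by rewrite cover_all.
Qed.

Lemma card_unc2 v w : v \in V0 -> w \in V0 ->
  #|uncovered f g C D v :|: uncovered f g C D w| <= 2 * beta.
Proof. move=> /card_unc h /card_unc h'; rewrite cardsU; move: h h'; clear; lia. Qed.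

Lemma coveredE v w : v \in V0 -> w \in V0 -> side w != side v -> w \notin uncovered f g C D v ->
  covered f g C D v w.
Proof. by rewrite inE => vV -> -> /=; rewrite negbK. Qed.

Lemma covered_same v w : covered f g C D v w -> f v = f w \/ g v = g w.
Proof. by case/orP => /andP[/eqP]; [left|right]. Qed.

(** Let [v], [w] on the side differ under [g]. An opposite [y] covered with both cannot agree with
    both under [g], so [f y = x]; it can be chosen outside [C]. A vertex [z] covered with [y] and
    outside the covers of [x] and of [g y] is then joined to [y] through [g], so it avoids both [C]
    and [D], against [cover_all]. *)
Lemma no_single_component s (x : T1) : (forall v, v \in V0 -> side v = s -> f v = x) -> False.
Proof.
move=> fx.
have [/exists_inP[v]|/exists_inPn gs] :=
    boolP [exists v in half s, exists w in half s, g v != g w]; last first.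
  have [|v [vV sv _]] := @pick_half s set0; first by rewrite cards0; apply: leq_trans (card_half s).
  apply: (@no_single_type s x (g v) set0) => [|w wV sw _]; first by rewrite cards0.
  have vh : v \in half s by rewrite inE vV sv eqxx.
  split; first exact: fx.
  have /exists_inPn/(_ w) := gs v vh; rewrite negbK inE wV sw eqxx => /(_ isT) /eqP ->.
  by [].
rewrite inE => /andP[vV /eqP sv] /exists_inP[w]; rewrite inE => /andP[wV /eqP sw] gvw.
have [|y [yV sy]] := @pick_half (~~ s)
    ((uncovered f g C D v :|: uncovered f g C D w) :|: cover_at f C x).
  apply: leq_trans (card_half _); rewrite ltnS cardsU; move: (cardC x) (card_unc2 vV wV); clear; lia.
rewrite !(in_setU, negb_or) -andbA => /and3P[y1 y2 yC].
have nside z : side z = s -> side y != side z by move=> ->; rewrite sy; case: (s).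
have fy : f y = x.
  have /covered_same := coveredE vV yV (nside _ sv) y1.
  have /covered_same := coveredE wV yV (nside _ sw) y2.
  rewrite (fx v vV sv) (fx w wV sw) => -[<-//|gw] [<-//|gv]; by rewrite gv gw eqxx in gvw.
have {yC}yC : y \notin C by move: yC; rewrite inE fy eqxx andbT.
have [|z [zV sz]] := @pick_half s (uncovered f g C D y :|: (cover_at f C x :|: cover_at g D (g y))).
  apply: leq_trans (card_half _); rewrite ltnS.
  rewrite !cardsU; move: (cardC x) (cardD (g y)) (card_unc yV); clear; lia.
rewrite !in_setU !negb_or => /and3P[z1]; rewrite !inE fx // eqxx andbT => zC zD.
have := coveredE yV zV _ z1; rewrite eq_sym nside // => /(_ isT).
rewrite /covered (negPf yC) (negPf zC) andbF /= => /andP[/eqP gz _].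
by have := cover_all zV; rewrite (negPf zC) /=; move: zD; rewrite gz eqxx andbT => /negPf->.
Qed.

End Cover.

Section Main.
Variables (T1 T2 : eqType) (f : V -> T1) (g : V -> T2) (C D : {set V}) (a b beta : nat).
Hypothesis cardC : forall t, #|cover_at f C t| <= a.
Hypothesis cardD : forall t, #|cover_at g D t| <= b.
Hypothesis card_unc : forall v, v \in V0 -> #|uncovered f g C D v| <= beta.
Hypothesis card_half : forall s, a + b + 2 * beta < #|half s|.

(* [f] and [g] are the components of the two colours.  Two vertices on one side
   that differ in both colours force a two-by-two structure, in which four covers
   would contain everything; otherwise one side lies in a single component. *)
Lemma no_two_covers : False.
Proof.
have [/exists_inP[v]|/exists_inPn same] :=
    boolP [exists v in half true, exists w in half true, (f v != f w) && (g v != g w)]; last first.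
  have line v w : v \in half true -> w \in half true -> f v <> f w -> g v = g w.
    move=> /same/exists_inPn/(_ w) h /h; rewrite negb_and !negbK => /orP[/eqP|/eqP] //.
  have [/exists_inP[v vh /exists_inP[w wh /eqP fvw]]|/exists_inPn fs] :=
    boolP [exists v in half true, exists w in half true, f v != f w].
    apply: (@no_single_component _ _ g f D C b a beta cardD cardC _ _ true (g v)).
    - move=> y /card_unc; congr (_ <= _); apply: eq_card => z; rewrite !inE; congr (_ && (_ && ~~ _)).
      by rewrite /covered orbC.
    - by move=> s; rewrite [b + a]addnC.
    - move=> z zV sz; have zh : z \in half true by rewrite inE zV sz.
      have [fz|/eqP fz] := eqVneq (f z) (f v); last exact: line.
      by rewrite (line v w) //; apply: line => //; rewrite fz.
  have [|v [vV sv _]] := @pick_half true set0.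
    by rewrite cards0; apply: leq_trans (card_half _).
  apply: (@no_single_component _ _ f g C D a b beta cardC cardD card_unc card_half true (f v))
    => z zV sz.
  have vh : v \in half true by rewrite inE vV sv.
  have /exists_inPn/(_ z) := fs v vh; rewrite negbK inE zV sz => /(_ isT) /eqP->//.
rewrite inE => /andP[vV /eqP sv] /exists_inP[w]; rewrite inE => /andP[wV /eqP sw] /andP[fvw gvw].
have typ (v1 v2 : V) s y : v1 \in V0 -> v2 \in V0 -> side v1 = ~~ s -> side v2 = ~~ s ->
   f v1 != f v2 -> g v1 != g v2 -> y \in V0 -> side y = s ->
   y \notin (uncovered f g C D v1 :|: uncovered f g C D v2) ->
   f y = f v1 /\ g y = g v2 \/ f y = f v2 /\ g y = g v1.
  move=> v1V v2V s1 s2 f12 g12 yV sy; rewrite in_setU => /norP[y1 y2].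
  have nside z : side z = ~~ s -> side y != side z by move=> ->; rewrite sy; case: (s).
  have /covered_same := coveredE v1V yV (nside _ s1) y1.
  have /covered_same := coveredE v2V yV (nside _ s2) y2.
  case=> <- [] h; rewrite ?h ?eqxx // in f12 g12 *; first by right.
  by left.
have unc2 := card_unc2 card_unc.
(* By [typ], opposite vertices have one of two mixed types, up to [2 * beta] exceptions. If one type
   is missing, [no_single_type] applies to the other; if both occur, their representatives play the
   roles of [v] and [w] for the first side. *)
have [/exists_inP[y1 y1h /andP[/eqP fy1 /eqP gy1]]|/exists_inPn no1] :=
    boolP [exists y in half false, (f y == f v) && (g y == g w)]; last first.
  apply: (@no_single_type _ _ f g C D a b beta cardC cardD card_unc card_half false
    (f w) (g v) _ (unc2 v w vV wV)).
  move=> y yV sy yn; have [[fy gy]|//] := typ v w false y vV wV sv sw fvw gvw yV sy yn.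
  by have := no1 y; rewrite inE yV sy fy gy !eqxx => /(_ isT).
have [/exists_inP[y2 y2h /andP[/eqP fy2 /eqP gy2]]|/exists_inPn no2] :=
    boolP [exists y in half false, (f y == f w) && (g y == g v)]; last first.
  apply: (@no_single_type _ _ f g C D a b beta cardC cardD card_unc card_half false
    (f v) (g w) _ (unc2 v w vV wV)).
  move=> y yV sy yn; have [//|[fy gy]] := typ v w false y vV wV sv sw fvw gvw yV sy yn.
  by have := no2 y; rewrite inE yV sy fy gy !eqxx => /(_ isT).
move: y1h y2h; rewrite !inE => /andP[y1V /eqP s1] /andP[y2V /eqP s2].
(* All but [2 * beta] vertices of each side will lie in these four covers, while the two sides
   together have more than [2 * a + 2 * b + 4 * beta] vertices. *)
pose S := (cover_at f C (f v) :|: cover_at f C (f w)) :|: (cover_at g D (g v) :|: cover_at g D (g w)).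
have cS : #|S| <= 2 * a + 2 * b.
  rewrite !cardsU; move: (cardC (f v)) (cardC (f w)) (cardD (g v)) (cardD (g w)); clear; lia.
have inS y : y \in V0 -> f y = f v \/ f y = f w -> g y = g v \/ g y = g w -> y \in S.
  move=> yV fy gy; rewrite !inE.
  have /orP[->|->] := cover_all cardC cardD card_unc card_half yV => /=.
    by case: fy => ->; rewrite eqxx ?orbT.
  by case: gy => ->; rewrite eqxx ?orbT.
have sub1 : half false \subset (uncovered f g C D v :|: uncovered f g C D w) :|: (S :&: half false).
  apply/subsetP => y yh; move: (yh); rewrite inE => /andP[yV /eqP sy].
  have [|yn] := boolP (y \in uncovered f g C D v :|: uncovered f g C D w).
    by rewrite [in X in _ -> X]in_setU => ->.
  rewrite in_setU [y \in S :&: _]in_setI yh andbT inS ?orbT //.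
    by have [[]|[]] := typ v w false y vV wV sv sw fvw gvw yV sy yn; auto.
  by have [[]|[]] := typ v w false y vV wV sv sw fvw gvw yV sy yn; auto.
have f12 : f y1 != f y2 by rewrite fy1 fy2.
have g12 : g y1 != g y2 by rewrite gy1 gy2 eq_sym.
have sub2 : half true \subset (uncovered f g C D y1 :|: uncovered f g C D y2) :|: (S :&: half true).
  apply/subsetP => y yh; move: (yh); rewrite inE => /andP[yV /eqP sy].
  have [|yn] := boolP (y \in uncovered f g C D y1 :|: uncovered f g C D y2).
    by rewrite [in X in _ -> X]in_setU => ->.
  have := typ y1 y2 true y y1V y2V s1 s2 f12 g12 yV sy yn; rewrite fy1 fy2 gy1 gy2 => ty.
  by rewrite in_setU [y \in S :&: _]in_setI yh andbT inS ?orbT //; case: ty => -[]; auto.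
have disj : #|S :&: half false| + #|S :&: half true| <= #|S|.
  rewrite -cardsUI (_ : (S :&: half false) :&: _ = set0) ?cards0 ?addn0.
    by apply: subset_leq_card; rewrite -setIUr subsetIl.
  by apply/setP => z; rewrite !inE; case: (side z); rewrite /= ?andbF.
move: (leq_trans (subset_leq_card sub1) (leq_card_setU _ _)).
move: (leq_trans (subset_leq_card sub2) (leq_card_setU _ _)).
move: (unc2 _ _ vV wV) (unc2 _ _ y1V y2V) (card_half true) (card_half false) disj cS.
clear; lia.
Qed.

End Main.
End TwoCovers.

(** * Closed walks *)

Section ClosedWalks.
Variables (I : finType) (G : rel I).
Hypothesis G_sym : symmetric G.

(** A visit to [i] is replaced by the detour [i, j, i]. The length grows by two, so even lengths
    stay even. *)
Lemma cycle_insert (w : seq I) i j : cycle G w -> i \in w -> G i j ->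
  exists2 w', cycle G w' & perm_eq w' [:: i, j & w].
Proof.
move=> cw iw Gij; have [k s Es] := rot_to iw; exists [:: i, j, i & s].
  by move: cw; rewrite -(rot_cycle k) Es /= => ->; rewrite [G j i]G_sym Gij.
by rewrite !perm_cons -Es perm_rot.
Qed.

Lemma cycle_insert_seq (L : seq (I * I)) (w : seq I) : cycle G w ->
    (forall p, p \in L -> p.1 \in w /\ G p.1 p.2) ->
  exists2 w', cycle G w' & perm_eq w' (map fst L ++ map snd L ++ w).
Proof.
move=> cw; elim: L => [|[i j] L IH] LP; first by exists w.
have [p pL|w1 cw1 pw1] := IH; first by apply: LP; rewrite inE pL orbT.
have [iw Gij] := LP (i, j) (mem_head _ _).
have [|w2 cw2 pw2] := cycle_insert cw1 _ Gij.
  by rewrite (perm_mem pw1) !mem_cat iw !orbT.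
exists w2 => //; apply: perm_trans pw2 _; rewrite /= perm_cons.
apply: perm_trans (_ : perm_eq (j :: (map fst L ++ map snd L ++ w)) _); first by rewrite perm_cons.
by rewrite -cat1s perm_catCA.
Qed.

(** Detours to unvisited neighbours are added as long as possible. Each reaches a new vertex at the
    cost of two steps, which bounds [k]; at the end the visited set is closed under [G] and so
    contains the component. *)
Lemma spanning_closed_walk i0 j0 : G i0 j0 -> exists (w : seq I) k,
  [/\ cycle G w, size w = 2 * k, k <= #|I|.+1 & forall c, connect G i0 c -> c \in w].
Proof.
move=> Gij; suff H n : forall w k, cycle G w -> i0 \in w -> size w = 2 * k ->
    k <= #|[set c in w]|.+1 -> #|~: [set c in w]| <= n -> exists (w : seq I) k,
  [/\ cycle G w, size w = 2 * k, k <= #|I|.+1 & forall c, connect G i0 c -> c \in w].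
  apply: (H _ [:: i0; j0] 1 _ _ _ _ (leqnn _)) => //=; first by rewrite Gij G_sym Gij.
  by rewrite mem_head.
elim: n => [|n IH] w k cw iw sw kw nw.
  exists w, k; split=> //; first by apply: leq_trans kw _; rewrite ltnS max_card.
  move=> c _; move: nw; rewrite leqn0 cards_eq0 => /eqP/setP/(_ c); rewrite !inE.
  by move/negbT; rewrite negbK.
have [/exists_inP[i iw' /existsP[j /andP[Gij' jw]]]|/exists_inPn cl] :=
    boolP [exists i in w, exists j, G i j && (j \notin w)].
  have [w' cw' pw'] := cycle_insert cw iw' Gij'.
  have E : [set c in w'] = j |: [set c in w].
    by apply/setP => c; rewrite !inE (perm_mem pw') !inE; case: eqVneq => // ->; rewrite iw' orbT.
  apply: (IH w' k.+1) => //.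
  - by rewrite (perm_mem pw') !inE iw !orbT.
  - by rewrite (perm_size pw') /= sw mulnS.
  - by rewrite E cardsU1 inE jw add1n.
  - rewrite E setCU; apply: leq_trans (_ : #|~: [set c in w] :\ j| <= n).
      by apply: subset_leq_card; apply/subsetP => x; rewrite !inE.
    by move: nw; rewrite (cardsD1 j) !inE jw.
exists w, k; split=> //; first by apply: leq_trans kw _; rewrite ltnS max_card.
have clo : closed G (mem w).
  have step i j : G i j -> i \in w -> j \in w.
    by move=> Gij' /cl/existsPn/(_ j); rewrite Gij' negbK.
  by move=> i j Gij'; apply/idP/idP; apply: step; rewrite // G_sym.
by move=> c /(closed_connect clo) <-.
Qed.

Lemma closed_walk_of_size (L : seq (I * I)) i0 a :
    (forall p, p \in L -> connect G i0 p.1 /\ G p.1 p.2) ->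
    #|I| < a -> a <= size L ->
  exists w, [/\ cycle G w, size w = 2 * a &
    forall c, count_mem c w <= count_mem c (map fst L ++ map snd L) + 2 * #|I|.+1].
Proof.
move=> LP Ia aL; case EL: L => [|[i1 j1] L']; first by move: aL Ia; rewrite EL /=; lia.
have [ci1 Gij] := LP (i1, j1) (eq_ind_r (fun L => _ \in L) (mem_head _ _) EL).
rewrite -EL; have [w0 [k [cw0 sw0 k0 conn]]] := spanning_closed_walk Gij.
(* The spanning walk has length [2 * k] already, so [a - k] edges of [L] bring it to [2 * a];
   [#|I| < a] ensures [k <= a]. *)
have [|w cw pw] := @cycle_insert_seq (take (a - k) L) _ cw0.
  move=> p /mem_take/LP[cp Gp]; split=> //; apply: conn.
  by apply: connect_trans cp; rewrite (sym_connect_sym G_sym).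
exists w; split=> //.
  rewrite (perm_size pw) !size_cat !size_map size_takel ?sw0; last by lia.
  by move: k0 Ia; lia.
move=> c; rewrite (permP pw) !count_cat addnA leq_add //.
  by rewrite -[in X in _ <= X](cat_take_drop (a - k) L) !map_cat !count_cat; clear; lia.
by apply: leq_trans (count_size _ _) _; rewrite sw0 leq_mul2l k0.
Qed.

End ClosedWalks.

(** * Cycles in colour classes *)

Definition bip_rel (A B : Type) (r : A -> B -> bool) : rel (A + B) := fun s t =>
  match s, t with inl a, inr b => r a b | inr b, inl a => r a b | _, _ => false end.

Lemma bip_rel_sym (A B : Type) (r : A -> B -> bool) : symmetric (bip_rel r).
Proof. by move=> [?|?] [?|?]. Qed.

Definition has_cycle (T : eqType) (E : rel T) n := exists s, [/\ size s = n, uniq s & cycle E s].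

Lemma cycle_nth (T : Type) (x0 : T) (E : rel T) (s : seq T) i :
  cycle E s -> i < size s -> E (nth x0 s i) (nth x0 s (i.+1 %% size s)).
Proof.
case: s => // x p /= /(pathP x0)/(_ i); rewrite size_rcons => Es ltis.
have := Es ltis; rewrite -[x :: rcons p x]rcons_cons !nth_rcons /= ltis.
have [lt|] := ltnP i (size p); first by rewrite modn_small.
rewrite leq_eqVlt ltnNge -ltnS ltis orbF => /eqP ->; by rewrite eqxx modnn.
Qed.

Lemma has_cycle_copy (G : sgraph) n :
  has_cycle (@adj G) n -> contains_copy G (cycle_graph n).
Proof.
case: n => [_|n [s [ss us cs]]].
  have no (i : 'I_0) : False by case: i.
  by exists (fun i => False_rect G (no i)); split=> i; case: (no i).
case: s => [|x0 p] // in ss us cs *; set s := x0 :: p in ss us cs.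
exists (fun i : 'I_n.+1 => nth x0 s i); split=> [i j /eqP|i j].
  by rewrite nth_uniq ?ss // => /eqP/val_inj.
have step k : adj (nth x0 s (k : 'I_n.+1)) (nth x0 s (ordS k)).
  by have := @cycle_nth _ x0 _ _ k cs; rewrite ss; apply.
by case/andP=> _ /orP[/eqP->//|/eqP->]; rewrite adj_sym.
Qed.

Lemma arrows_of_two_color_cycles N a b :
    (forall e : 'I_N -> 'I_N -> bool,
       has_cycle (bip_rel e) (2 * a) \/ has_cycle (bip_rel (fun x y => ~~ e x y)) (2 * b)) ->
  arrows (complete_bipartite N N) (pair_family (cycle_graph (2 * a)) (cycle_graph (2 * b))).
Proof.
move=> H c; pose e (x y : 'I_N) := c [set inl x; inr y] == ord0.
have sub (r : 'I_N -> 'I_N -> bool) (i : 'I_2) n :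
   (forall x y, r x y -> c [set inl x; inr y] == i) ->
   has_cycle (bip_rel r) n -> contains_copy (color_class c i) (cycle_graph n).
  move=> ri [s [ss us cs]]; apply: has_cycle_copy; exists s; split=> //.
  apply: sub_cycle cs => -[x|y] [x'|y'] //=; rewrite /color_adj /=; first exact: ri.
  by rewrite setUC; apply: ri.
have [h|h] := H e; [exists ord0|exists ord_max]; rewrite /pair_family /=.
  by apply: sub h.
apply: sub h => x y; rewrite /e; case: (c _) => -[|[|]] //.
Qed.

(** The edges joining positions [2 * j] and [2 * j + 1] of the cycle are [k] disjoint edges, so
    their ends in [P] are distinct. *)
Lemma copy_left_card (M k : nat) (G : rel ('I_M + 'I_M)) (P : {set 'I_M})
    (f : 'I_(2 * k) -> 'I_M + 'I_M) : injective f ->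
    (forall u v, cycle_adj u v -> G (f u) (f v)) ->
    (forall v w, G v w -> exists2 x, x \in P & inl x \in [set v; w]) -> k <= #|P|.
Proof.
move=> fI fG GP.
have lt0 (j : 'I_k) : 2 * j < 2 * k by rewrite ltn_mul2l ltn_ord.
have lt1 (j : 'I_k) : (2 * j).+1 < 2 * k by move: (ltn_ord j); lia.
have /fin_all_exists[x xP] (j : 'I_k) : exists x,
    (x \in P) && (inl x \in [set f (Ordinal (lt0 j)); f (Ordinal (lt1 j))]).
  have [|x xP xin] := GP (f (Ordinal (lt0 j))) (f (Ordinal (lt1 j))); last by exists x; rewrite xP.
  apply: fG; apply/andP; split; first by rewrite -val_eqE /= neq_ltn ltnSn.
  by rewrite -!val_eqE /= modn_small ?eqxx.
have xI : injective x.
  move=> j j' Ej; have /andP[_] := xP j; have /andP[_] := xP j'; rewrite Ej !inE.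
  have odd_even (m n : nat) : (2 * m).+1 <> 2 * n by lia.
  move=> /orP[]/eqP-> /orP[]/eqP/fI/(congr1 val) /= E; apply: val_inj => /=; move: E; clear; lia.
rewrite -[k]card_ord -(card_imset _ xI); apply: subset_leq_card.
by apply/subsetP => _ /imsetP[j _ ->]; case/andP: (xP j).
Qed.

Lemma card_ord_lt M n : #|[set x : 'I_M | x < n]| <= n.
Proof.
rewrite cardE -(size_map val) -[n in _ <= n](size_iota 0).
apply: uniq_leq_size; first by rewrite (map_inj_uniq val_inj) enum_uniq.
by move=> y /mapP[x + ->]; rewrite mem_enum inE mem_iota.
Qed.

Lemma card_ord_ge M n : #|[set x : 'I_M | n <= x]| <= M - n.
Proof.
rewrite cardE -(size_map val) -[X in _ <= X](size_iota n).
apply: uniq_leq_size; first by rewrite (map_inj_uniq val_inj) enum_uniq.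
move=> y /mapP[x + ->]; rewrite mem_enum inE mem_iota => nx.
by rewrite nx /=; move: nx (ltn_ord x); clear; lia.
Qed.

Lemma arrows_cycles_ge M a b : 0 < a -> 0 < b ->
  arrows (complete_bipartite M M) (pair_family (cycle_graph (2 * a)) (cycle_graph (2 * b))) ->
  a + b <= M.+1.
Proof.
move=> a0 b0 /(_ [ffun S : {set 'I_M + 'I_M} =>
   if [exists x : 'I_M, (inl x \in S) && (x < a.-1)] then ord0 else ord_max]) [i].
rewrite /pair_family; have [->|ni] := eqVneq i ord0 => -[f [fI fG]].
  suff : a <= #|[set x : 'I_M | x < a.-1]|.
    by move/leq_trans/(_ (card_ord_lt M a.-1)); rewrite leqNgt prednK ?leqnn.
  apply: (copy_left_card fI fG) => v w /andP[_]; rewrite ffunE.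
  case: ifP => // /existsP[x /andP[xS xa]] _.
  by exists x; rewrite // inE.
suff : b <= #|[set x : 'I_M | a.-1 <= x]|.
  by move/leq_trans/(_ (card_ord_ge M a.-1)); move: a0 b0; clear; lia.
apply: (copy_left_card fI fG) => v w /andP[vw]; rewrite ffunE.
case: ifP => [_ /eqP i0|/negbT/existsPn nx _]; first by rewrite -i0 eqxx in ni.
case: v w vw nx => [x|y] [x'|y'] //= _ nx.
  by exists x; rewrite ?inE ?eqxx //; have := nx x; rewrite !inE eqxx /= -leqNgt.
by exists x'; rewrite ?inE ?eqxx ?orbT //; have := nx x'; rewrite !inE eqxx orbT /= -leqNgt.
Qed.

Import Order.TTheory GRing.Theory Num.Theory.
Local Open Scope ring_scope.

(** * A weak regularity lemma *)

Section Regularity.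
Variable R : archiRealFieldType.

Definition edge_count (X Y : finType) (e : X -> Y -> bool) (A : {set X}) (B : {set Y}) : R :=
  \sum_(x in A) \sum_(y in B) (e x y)%:R.

Definition quarter_dense (eps : R) (X Y : finType) (e : X -> Y -> bool)
    (A : {set X}) (B : {set Y}) :=
  [forall A' : {set X}, forall B' : {set Y},
    [==> A' \subset A, B' \subset B, eps * #|A|%:R <= #|A'|%:R, eps * #|B|%:R <= #|B'|%:R
     => #|A'|%:R * #|B'|%:R / 4 <= edge_count e A' B']].

Definition fib (X I : finType) (f : X -> I) (i : I) : {set X} := [set x | f x == i].

Definition sqdist (X Y : finType) (e : X -> Y -> bool) (h : X -> Y -> R) : R :=
  \sum_x \sum_y ((e x y)%:R - h x y) ^+ 2.

Lemma in_fib (X I : finType) (f : X -> I) i x : (x \in fib f i) = (f x == i).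
Proof. by rewrite inE. Qed.

Lemma sum_fib (X I : finType) (f : X -> I) (F : X -> R) :
  \sum_x F x = \sum_i \sum_(x in fib f i) F x.
Proof.
rewrite (partition_big f xpredT) //=; apply: eq_bigr => i _.
by apply: eq_bigl => x; rewrite inE.
Qed.

Lemma sum_fib2 (X Y I J : finType) (f : X -> I) (g : Y -> J) (F : X -> Y -> R) :
  \sum_x \sum_y F x y = \sum_p \sum_(x in fib f p.1) \sum_(y in fib g p.2) F x y.
Proof.
rewrite -(pair_bigA _ (fun i j => \sum_(x in fib f i) \sum_(y in fib g j) F x y)) /=.
rewrite (sum_fib f); apply: eq_bigr => i _; rewrite [RHS]exchange_big /=.
by apply: eq_bigr => x _; rewrite (sum_fib g).
Qed.

Lemma natr_card (X : finType) (A : {set X}) : #|A|%:R = \sum_(x in A) 1 :> R.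
Proof. by rewrite sumr_const. Qed.

Lemma edge_countC (X Y : finType) (e : X -> Y -> bool) A B :
  edge_count (fun x y => ~~ e x y) A B = #|A|%:R * #|B|%:R - edge_count e A B.
Proof.
apply: (addIr (edge_count e A B)); rewrite subrK /edge_count -big_split /=.
rewrite (natr_card A) mulr_suml; apply: eq_bigr => x _.
rewrite -big_split /= mul1r natr_card; apply: eq_bigr => y _.
by case: (e x y); rewrite ?addr0 ?add0r.
Qed.

Lemma sqdist_const (X Y : finType) (e : X -> Y -> bool) (A : {set X}) (B : {set Y}) c :
  \sum_(x in A) \sum_(y in B) ((e x y)%:R - c) ^+ 2 =
  (1 - 2 * c) * edge_count e A B + c ^+ 2 * (#|A|%:R * #|B|%:R).
Proof.
rewrite /edge_count (natr_card A) mulr_suml !mulr_sumr -big_split /=.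
apply: eq_bigr => x _; rewrite mul1r (natr_card B) !mulr_sumr -big_split /=.
apply: eq_bigr => y _; case: (e x y) => /=; ring.
Qed.

Lemma sqdist_const_shift (X Y : finType) (e : X -> Y -> bool)
    (A A' : {set X}) (B B' : {set Y}) c d :
  A' \subset A -> B' \subset B ->
  \sum_(x in A) \sum_(y in B) ((e x y)%:R - (c + if (x \in A') && (y \in B') then d else 0)) ^+ 2 =
  \sum_(x in A) \sum_(y in B) ((e x y)%:R - c) ^+ 2
   - 2 * d * edge_count e A' B' + (2 * c * d + d ^+ 2) * (#|A'|%:R * #|B'|%:R).
Proof.
move=> sA sB.
have step x y : ((e x y)%:R - (c + if (x \in A') && (y \in B') then d else 0)) ^+ 2 =
   ((e x y)%:R - c) ^+ 2 +
     (if (x \in A') && (y \in B') then ((e x y)%:R - (c + d)) ^+ 2 - ((e x y)%:R - c) ^+ 2 else 0).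
  by case: ifP => _; ring.
under eq_bigr => x _ do under eq_bigr => y _ do rewrite step.
under eq_bigr do rewrite big_split /=.
rewrite big_split /= -addrA; congr (_ + _).
transitivity (\sum_(x in A') \sum_(y in B')
     (((e x y)%:R - (c + d)) ^+ 2 - ((e x y)%:R - c) ^+ 2)).
  rewrite [RHS]big_mkcond [LHS]big_mkcond; apply: eq_bigr => x _.
  case: (boolP (x \in A')) => [/(subsetP sA) ->|_] /=; last by rewrite big1_eq if_same.
  rewrite [RHS]big_mkcond [LHS]big_mkcond; apply: eq_bigr => y _.
  by case: (boolP (y \in B')) => [/(subsetP sB) ->|_] //=; rewrite if_same.
under eq_bigr do rewrite sumrB.
rewrite sumrB !sqdist_const; ring.
Qed.

Lemma edge_count_bound (X Y : finType) (e : X -> Y -> bool) A B :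
  0 <= edge_count e A B <= #|A|%:R * #|B|%:R.
Proof.
have ge0 e' : 0 <= edge_count e' A B by do 2![apply: sumr_ge0 => ? _]; apply: ler0n.
by rewrite ge0 -subr_ge0 -edge_countC ge0.
Qed.

Definition density (X Y : finType) (e : X -> Y -> bool) (A : {set X}) (B : {set Y}) : R :=
  edge_count e A B / (#|A|%:R * #|B|%:R).

Lemma densityK (X Y : finType) (e : X -> Y -> bool) (A : {set X}) (B : {set Y}) :
  edge_count e A B = density e A B * (#|A|%:R * #|B|%:R).
Proof.
rewrite /density; have [n0|n0] := eqVneq (#|A|%:R * #|B|%:R : R) 0; last by rewrite divfK.
by have := edge_count_bound e A B; rewrite n0 mulr0; lra.
Qed.

(** The density is the mean of [e] on the pair, and the mean minimises the squared distance. *)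
Lemma sqdist_density_le (X Y : finType) (e : X -> Y -> bool) (A : {set X}) (B : {set Y}) c :
  \sum_(x in A) \sum_(y in B) ((e x y)%:R - density e A B) ^+ 2 <=
  \sum_(x in A) \sum_(y in B) ((e x y)%:R - c) ^+ 2.
Proof.
rewrite !sqdist_const densityK; set n := _ * _%:R; set d := density _ _ _.
have n0 : 0 <= n by rewrite mulr_ge0 ?ler0n.
have -> : (1 - 2 * c) * (d * n) + c ^+ 2 * n =
  (1 - 2 * d) * (d * n) + d ^+ 2 * n + (c - d) ^+ 2 * n by ring.
by rewrite lerDl mulr_ge0 ?sqr_ge0.
Qed.

Definition irregular (eps : R) (X Y : finType) (e : X -> Y -> bool) (A : {set X}) (B : {set Y}) :=
  ~~ quarter_dense eps e A B && ~~ quarter_dense eps (fun x y => ~~ e x y) A B.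

Lemma dense_witness (eps : R) (X Y : finType) (e : X -> Y -> bool) (A : {set X}) (B : {set Y}) :
  0 <= eps -> ~~ quarter_dense eps e A B -> exists (A' : {set X}) (B' : {set Y}),
  [/\ A' \subset A, B' \subset B, edge_count e A' B' < #|A'|%:R * #|B'|%:R / 4 &
   eps ^+ 2 * (#|A|%:R * #|B|%:R) <= #|A'|%:R * #|B'|%:R].
Proof.
move=> eps0; rewrite negb_forall => /existsP[A']; rewrite negb_forall => /existsP[B'].
rewrite !negb_imply -ltNge => /and5P[sA sB lA lB lt]; exists A', B'; split=> //.
rewrite expr2 mulrACA; apply: ler_pM => //; exact: mulr_ge0.
Qed.

(** In a colour of density at least 1/2, a witness has density below 1/4. Moving the constant by 1/4
    towards it on the witness changes the squared distance by at most [1/8 - 1/4 + 1/16 = - 1/16] of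
    the size of the witness, which is at least [eps ^+ 2] of the whole pair. *)
Lemma irregular_gain (eps : R) (X Y : finType) (e : X -> Y -> bool) (A : {set X}) (B : {set Y}) :
  0 <= eps -> irregular eps e A B -> exists (A' : {set X}) (B' : {set Y}) d,
  [/\ A' \subset A, B' \subset B &
  \sum_(x in A) \sum_(y in B)
     ((e x y)%:R - (density e A B + if (x \in A') && (y \in B') then d else 0)) ^+ 2 <=
  \sum_(x in A) \sum_(y in B) ((e x y)%:R - density e A B) ^+ 2
    - eps ^+ 2 / 16 * (#|A|%:R * #|B|%:R)].
Proof.
move=> eps0 /andP[/dense_witness W1 /dense_witness W2].
have [c2|c2] := leP (1 / 2) (density e A B).
  have [A' [B' [sA sB lt le]]] := W1 eps0; exists A', B', (- (1 / 4)); split=> //.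
  rewrite sqdist_const_shift //; set n := #|A'|%:R * _ in lt le *.
  have : 0 <= (density e A B - 1 / 2) * n by rewrite mulr_ge0 ?subr_ge0 // mulr_ge0 ?ler0n.
  by move: lt le => *; nra.
have [A' [B' [sA sB lt le]]] := W2 eps0; exists A', B', (1 / 4); split=> //.
rewrite sqdist_const_shift //; move: lt; rewrite edge_countC; set n := #|A'|%:R * _ in le * => lt.
have : 0 <= (1 / 2 - density e A B) * n by rewrite mulr_ge0 ?subr_ge0 ?(ltW c2) // mulr_ge0 ?ler0n.
by move: lt le => *; nra.
Qed.

Definition irregular_mass (eps : R) (X Y I : finType) (e : X -> Y -> bool)
    (f : X -> I) (g : Y -> I) : R :=
  \sum_(p | irregular eps e (fib f p.1) (fib g p.2)) #|fib f p.1|%:R * #|fib g p.2|%:R.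

(** Each irregular pair gains [eps ^+ 2 / 16] of its size, and irregular pairs have more than an
    [eps] fraction of the total size, whence the cube. On the other pairs the density does at least
    as well as [h]. *)
Lemma refine_step (eps : R) (X Y I : finType) (e : X -> Y -> bool)
    (f : X -> I) (g : Y -> I) (h : I -> I -> R) : 0 <= eps ->
  eps * (#|X|%:R * #|Y|%:R) < irregular_mass eps e f g ->
  exists (f' : X -> I * {set I}) (g' : Y -> I * {set I}) (h' : I * {set I} -> I * {set I} -> R),
  sqdist e (fun x y => h' (f' x) (g' y)) <=
    sqdist e (fun x y => h (f x) (g y)) - eps ^+ 3 / 16 * (#|X|%:R * #|Y|%:R).
Proof.
move=> eps0 big.
pose c (p : I * I) := density e (fib f p.1) (fib g p.2).
have /fin_all_exists[w wP] (p : I * I) : exists w : {set X} * {set Y} * R,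
  \sum_(x in fib f p.1) \sum_(y in fib g p.2)
     ((e x y)%:R - (c p + if (x \in w.1.1) && (y \in w.1.2) then w.2 else 0)) ^+ 2 <=
  \sum_(x in fib f p.1) \sum_(y in fib g p.2) ((e x y)%:R - h p.1 p.2) ^+ 2
    - if irregular eps e (fib f p.1) (fib g p.2)
      then eps ^+ 2 / 16 * (#|fib f p.1|%:R * #|fib g p.2|%:R) else 0.
  case: ifP => [/(irregular_gain eps0)[A [B [d [_ _ le]]]]|_].
    by exists (A, B, d); apply: le_trans le _; rewrite lerD2r sqdist_density_le.
  exists (set0, set0, 0); rewrite subr0 /=.
  under eq_bigr => x _ do under eq_bigr => y _ do rewrite if_same addr0.
  exact: sqdist_density_le.
(* The new label of [x] records on which pairs [x] lies in the witness, so the shifted densities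
   depend on the labels only. *)
exists (fun x => (f x, [set j | x \in (w (f x, j)).1.1])),
  (fun y => (g y, [set i | y \in (w (i, g y)).1.2])),
  (fun s t : I * {set I} => c (s.1, t.1) +
     if (t.1 \in s.2) && (s.1 \in t.2) then (w (s.1, t.1)).2 else 0).
rewrite /sqdist (sum_fib2 f g) [X in _ <= X - _](sum_fib2 f g) /=.
apply: (@le_trans _ _ (\sum_p (\sum_(x in fib f p.1) \sum_(y in fib g p.2)
      ((e x y)%:R - h p.1 p.2) ^+ 2
    - if irregular eps e (fib f p.1) (fib g p.2)
      then eps ^+ 2 / 16 * (#|fib f p.1|%:R * #|fib g p.2|%:R) else 0))).
  apply: ler_sum => p _; apply: le_trans (wP p); rewrite le_eqVlt; apply/orP; left; apply/eqP.
  apply: eq_bigr => x; rewrite in_fib => /eqP fx; apply: eq_bigr => y; rewrite in_fib => /eqP gy.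
  by rewrite !inE fx gy -surjective_pairing.
rewrite sumrB lerB //.
  rewrite le_eqVlt; apply/orP; left; apply/eqP; apply: eq_bigr => p _.
  apply: eq_bigr => x; rewrite in_fib => /eqP fx; apply: eq_bigr => y; rewrite in_fib => /eqP gy.
  by rewrite fx gy.
rewrite -big_mkcond -mulr_sumr -/(irregular_mass _ _ _ _).
have -> : eps ^+ 3 / 16 * (#|X|%:R * #|Y|%:R) = eps ^+ 2 / 16 * (eps * (#|X|%:R * #|Y|%:R)) by ring.
by rewrite ler_wpM2l ?(ltW big) // divr_ge0 ?sqr_ge0.
Qed.

(* Each refinement records the old cell of a vertex and the set of cells for which
   it belongs to the witness of irregularity. *)
Fixpoint label (j : nat) : finType :=
  if j is j'.+1 then (label j' * {set label j'})%type : finType else unit.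

Lemma label_card_le i j : (i <= j)%N -> (#|label i| <= #|label j|)%N.
Proof.
elim: j => [|j IH]; first by rewrite leqn0 => /eqP->.
rewrite leq_eqVlt => /orP[/eqP->//|/IH le]; apply: leq_trans le _ => /=.
by rewrite card_prod leq_pmulr // -cardsT; apply/card_gt0P; exists set0; rewrite inE.
Qed.

(* The potential is the least squared distance from [e] to a function constant on
   pairs of cells; [refine_step] decreases it by a fixed proportion. *)
Lemma regularity (eps : R) : 0 < eps -> exists K : nat,
  forall (X Y : finType) (e : X -> Y -> bool), exists (I : finType) (f : X -> I) (g : Y -> I),
  (#|I| <= K)%N /\ irregular_mass eps e f g <= eps * (#|X|%:R * #|Y|%:R).
Proof.
move=> eps0; pose q := eps ^+ 3 / 16; have q0 : 0 < q by rewrite divr_gt0 // exprn_gt0.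
(* The potential starts at no more than [#|X| * #|Y|] and each step removes [q] times this product,
   so [J > 1 / q] steps would make it negative. *)
pose J := (Num.truncn q^-1).+1; exists #|label J| => X Y e.
have [n0|n0] := eqVneq (#|X|%:R * #|Y|%:R : R) 0.
  exists unit, (fun=> tt), (fun=> tt); split; first exact: (@label_card_le 0 J).
  rewrite n0 mulr0 /irregular_mass big1 // => p _; apply/eqP; rewrite eq_le -{1}n0.
  by rewrite ler_pM ?ler_nat ?max_card //= mulr_ge0.
have n1 : 0 < #|X|%:R * #|Y|%:R :> R by rewrite lt_def n0 mulr_ge0.
suff /(_ J) [[j [jJ [f [g le]]]]|[f [g [h]]]] : forall j : nat,
    (exists j' : nat, (j' < j)%N /\ exists (f : X -> label j') (g : Y -> label j'),
       irregular_mass eps e f g <= eps * (#|X|%:R * #|Y|%:R))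
    \/ exists (f : X -> label j) (g : Y -> label j) h,
       sqdist e (fun x y => h (f x) (g y)) <= (1 - q * j%:R) * (#|X|%:R * #|Y|%:R).
- by exists (label j), f, g; split=> //; apply: label_card_le; apply: ltnW.
- move=> le; have : 0 <= (1 - q * J%:R) * (#|X|%:R * #|Y|%:R).
    apply: le_trans le; do 2![apply: sumr_ge0 => ? _]; exact: sqr_ge0.
  rewrite pmulr_lge0 // subr_ge0 -ler_pdivlMl // mulr1 => le1.
  by have := truncnS_gt q^-1; rewrite ltNge le1.
elim=> [|j [[j' [lt H]]|[f [g [h le]]]]].
- right; exists (fun=> tt), (fun=> tt), (fun _ _ => 0); rewrite mulr0 subr0 mul1r.
  have /andP[_] := edge_count_bound e setT setT; rewrite !cardsT; apply: le_trans.
  rewrite le_eqVlt; apply/orP; left; apply/eqP; apply: eq_big => [x|x _]; first by rewrite inE.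
  apply: eq_big => [y|y _]; first by rewrite inE.
  by rewrite subr0; case: (e x y); rewrite ?expr1n ?expr0n.
- by left; exists j'; split=> //; apply: ltn_trans lt _.
have [good|bad] := leP (irregular_mass eps e f g) (eps * (#|X|%:R * #|Y|%:R)).
  by left; exists j; split=> //; exists f, g.
have [f' [g' [h' le']]] := refine_step h (ltW eps0) bad.
right; exists f', g', h'; apply: le_trans le' _.
by move: le; rewrite -/q -[j.+1%:R]natr1 => le; nra.
Qed.
End Regularity.

(** * Embedding cycles along closed walks *)

Lemma exists_subset_card (T : finType) (A : {set T}) k : (k <= #|A|)%N ->
  exists2 B : {set T}, B \subset A & #|B| = k.
Proof.
move=> kA; exists [set x in take k (enum A)].
  by apply/subsetP => x; rewrite inE => /mem_take; rewrite mem_enum.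
rewrite cardsE (card_uniqP _) ?take_uniq ?enum_uniq // size_takel //.
by rewrite -cardE.
Qed.

Section Embedding.
Variables (R : archiRealFieldType) (V I : finType) (E : rel V) (cell : V -> I) (G : rel I).
Variables (eps tau : R).

Definition nbr v (T : {set V}) : {set V} := [set y in T | E v y].
Definition rich v (T : {set V}) := (#|T| <= 4 * #|nbr v T|)%N.

Hypothesis G_irr : forall c, ~~ G c c.
Hypothesis eps_gt0 : 0 < eps.
Hypothesis eps_tau : 4 * eps <= tau.
Hypothesis few_poor : forall c d (T : {set V}), G c d -> T \subset fib cell d ->
  eps * #|fib cell d|%:R <= #|T|%:R ->
  #|[set x in fib cell c | ~~ rich x T]|%:R < eps * #|fib cell c|%:R.

Lemma pick_rich c d (S T : {set V}) : G c d -> T \subset fib cell d ->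
  eps * #|fib cell d|%:R <= #|T|%:R -> S \subset fib cell c ->
  eps * #|fib cell c|%:R <= #|S|%:R -> exists2 x, x \in S & rich x T.
Proof.
move=> Gcd sT leT sS leS.
have /subsetPn[x xS] : ~~ (S \subset [set x in fib cell c | ~~ rich x T]).
  apply/negP => /subset_leq_card; rewrite -(ler_nat R) => le.
  by have := few_poor Gcd sT leT; rewrite ltNge (le_trans leS le).
by rewrite inE (subsetP sS) //= negbK; exists x.
Qed.

Definition target (F Z : {set V}) (p : seq I) := if p is d :: _ then fib cell d :\: F else Z.

(** Greedy induction on the walk, with the invariant that [v] is rich to the set where the next
    vertex must lie. At least a [tau] fraction of the next cell is free, so by [4 * eps <= tau] the
    neighbours of [v] there form an [eps] fraction of the cell, too many for all to be poor to the
    following target. *)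
Lemma path_embed (e : I) (Z : {set V}) p c v (F : {set V}) :
    Z \subset fib cell e -> (0 < #|Z|)%N -> eps * #|fib cell e|%:R <= #|Z|%:R ->
    path G c (rcons p e) ->
    (forall d, d \in p ->
       (count_mem d p)%:R + #|F :&: fib cell d|%:R + tau * #|fib cell d|%:R <= #|fib cell d|%:R) ->
    rich v (target F Z p) ->
  exists (s : seq V) z, [/\ size s = size p, uniq s, {in s, forall x, x \notin F},
     path E v s & z \in Z /\ E (last v s) z].
Proof.
move=> sZ Z0 leZ; elim: p => [|d p IH] in c v F *.
  move=> _ _ /= ri; have /card_gt0P[z] : (0 < #|nbr v Z|)%N.
    by rewrite -(ltn_pmul2l (isT : 0 < 4)%N) muln0; apply: leq_trans Z0 ri.
  by rewrite inE => /andP[zZ Evz]; exists [::], z.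
rewrite [rcons _ _]/= [path _ _ _]/= => /andP[Gcd wp] cap ri.
have tau0 : 0 < tau by move: eps_gt0 eps_tau => *; lra.
have cardD d' : #|fib cell d' :\: F|%:R = #|fib cell d'|%:R - #|F :&: fib cell d'|%:R :> R.
  by rewrite -(cardsID F (fib cell d')) natrD [F :&: _]setIC; ring.
have et0 (d' : I) : 4 * (eps * #|fib cell d'|%:R) <= tau * #|fib cell d'|%:R.
  by rewrite mulrA ler_wpM2r.
have e0 (d' : I) : 0 <= eps * #|fib cell d'|%:R by rewrite mulr_ge0 // ltW.
pose T := target F Z p.
have [x xS rx] : exists2 x, x \in nbr v (fib cell d :\: F) & rich x T.
  have sS : nbr v (fib cell d :\: F) \subset fib cell d.
    by apply/subsetP => x; rewrite !inE => /andP[/andP[]].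
  have leS : eps * #|fib cell d|%:R <= #|nbr v (fib cell d :\: F)|%:R.
    have cd := cap d (mem_head _ _); have cd0 := ler0n R (count_mem d (d :: p)).
    move: ri; rewrite /rich /target -(ler_nat R) natrM cardD => ri.
    have := et0 d; move: cd cd0 ri; lra.
  rewrite /T; case: (p) wp cap => [|d2 p2] /= /andP[Gd _] cap.
    exact: pick_rich Gd sZ leZ sS leS.
  apply: pick_rich Gd _ _ sS leS; first exact: subsetDl.
  have := cap d2; rewrite !inE eqxx orbT => /(_ isT); rewrite /target cardD.
  have := et0 d2; have := e0 d2; move: ((d == d2) + _)%N => n; have := ler0n R n; lra.
move: xS; rewrite !inE => /andP[/andP[xF /eqP xd] Evx].
have [||s [z [ss us sF ps [zZ lz]]]] := IH d x (x |: F) wp.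
- move=> d' d'p; have := cap d'; rewrite inE d'p orbT => /(_ isT); apply: le_trans.
  rewrite lerD2r /= -!natrD ler_nat addnC [X in (_ <= X)%N]addnC addnA leq_add2r.
  rewrite setIUl; apply: leq_trans (leq_card_setU _ _) _; rewrite addnC leq_add2l.
  have [dd'|ndd'] := eqVneq d d'; first by rewrite (leq_trans (subset_leq_card (subsetIl _ _))) ?cards1.
  rewrite leqn0 cards_eq0; apply/eqP/setP => y; rewrite !inE.
  by apply/andP => -[/eqP->]; rewrite xd (negPf ndd').
(* Using up [x] does not shrink the next target, because consecutive cells of the walk differ. *)
- suff -> : target (x |: F) Z p = T by [].
  rewrite /T; case: (p) wp => [|d2 p2] //= /andP[Gd _].
  apply/setP => y; rewrite !inE; case: eqVneq => [->|//] /=; rewrite xd.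
  by case: eqVneq => [dd|]; rewrite ?andbF //; have := G_irr d; rewrite {2}dd Gd.
exists (x :: s), z; split=> //=; first by rewrite ss.
- rewrite us andbT; apply/negP => /sF; by rewrite !inE eqxx.
- by move=> y; rewrite inE => /orP[/eqP->//|/sF]; rewrite inE negb_or => /andP[].
- by rewrite Evx.
Qed.

Hypothesis E_sym : symmetric E.
Hypothesis G_sym : symmetric G.

(* To close the cycle, a set [Z0] inside the last cell is reserved, and the second
   vertex is chosen with many neighbours in [Z0]. *)
Lemma cycle_embed (w : seq I) : (2 < size w)%N -> cycle G w ->
    (forall d, d \in w -> (count_mem d w)%:R + 2 * tau * #|fib cell d|%:R <= #|fib cell d|%:R) ->
  exists s : seq V, [/\ size s = size w, uniq s & cycle E s].
Proof.
case: w => [|e [|c [|d p]]] // _; rewrite [cycle _ _]/= => /and3P[Gec Gcd wp] cap.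
have tau0 : 0 < tau by move: eps_gt0 eps_tau => *; lra.
have et0 (d' : I) : 4 * (eps * #|fib cell d'|%:R) <= tau * #|fib cell d'|%:R.
  by rewrite mulrA ler_wpM2r.
have e0 (d' : I) : 0 <= eps * #|fib cell d'|%:R by rewrite mulr_ge0 // ltW.
have t0 (d' : I) : 0 <= tau * #|fib cell d'|%:R by rewrite mulr_ge0 // ltW.
have t2 (d' : I) : 2 * tau * #|fib cell d'|%:R = 2 * (tau * #|fib cell d'|%:R) by ring.
have tt1 : (nat_of_bool true)%:R = 1 :> R by [].
have ff0 : (nat_of_bool false)%:R = 0 :> R by [].
(* The reserve spends one of the two [tau] fractions granted by [cap], the path the other. The extra
   vertex due to rounding up is paid for by the visit of the walk to [e], and [v] by the visit to
   [c]. *)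
pose k := (Num.truncn (tau * #|fib cell e|%:R)).+1.
have kl : tau * #|fib cell e|%:R < k%:R by exact: truncnS_gt.
have kg : k%:R <= tau * #|fib cell e|%:R + 1 by rewrite /k -natr1 lerD2r truncn_le.
have [|Z0 sZ0 cZ0] := @exists_subset_card _ (fib cell e) k.
  rewrite -(ler_nat R); have := cap e (mem_head _ _); rewrite /= eqxx natrD t2.
  have := t0 e; move: kg; have := ler0n R ((c == e) + ((d == e) + count_mem e p))%N; lra.
have nce : c != e by apply: contraTneq Gec => ->.
have ncd : c != d by apply: contraTneq Gcd => ->.
pose T := fib cell d :\: Z0.
have cT : eps * #|fib cell d|%:R <= #|T|%:R.
  have cE : #|T|%:R = #|fib cell d|%:R - #|Z0 :&: fib cell d|%:R :> R.
    by rewrite -(cardsID Z0 (fib cell d)) natrD [Z0 :&: _]setIC; ring.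
  have := cap d; rewrite !inE eqxx !orbT => /(_ isT) /=; rewrite cE eqxx !natrD t2.
  have := et0 d; have := e0 d; have := t0 d; have := ler0n R (count_mem d p); have := ler0n R (c == d).
  have [ed|ned] := eqVneq e d.
    by rewrite -ed (setIidPl sZ0) cZ0; lra.
  suff -> : Z0 :&: fib cell d = set0 by rewrite cards0; lra.
  apply/setP => y; rewrite [in LHS]inE in_set0; apply/andP => -[/(subsetP sZ0)].
  by rewrite !in_fib => /eqP->; rewrite (negPf ned).
have le0 : eps * #|fib cell e|%:R <= #|Z0|%:R.
  by rewrite cZ0; have := et0 e; have := t0 e; have := e0 e; lra.
have [v vc /andP[rT rZ]] : exists2 v, v \in fib cell c & rich v T && rich v Z0.
  have /subsetPn[v vc] : ~~ (fib cell c \subset [set x in fib cell c | ~~ rich x T]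
                                            :|: [set x in fib cell c | ~~ rich x Z0]).
    apply/negP => /subset_leq_card/leq_trans/(_ (leq_card_setU _ _)).
    rewrite -(ler_nat R) natrD.
    have := few_poor Gcd (subsetDl _ _ : T \subset _) cT.
    have := few_poor (etrans (G_sym c e) Gec) sZ0 le0.
    have := cap c; rewrite !inE eqxx !orbT => /(_ isT) /=; rewrite eqxx !natrD t2.
    have := et0 c; have := e0 c; have := ler0n R (count_mem c p); have := ler0n R (d == c).
    have := ler0n R (e == c); lra.
  by rewrite !inE; move: (vc); rewrite in_fib => -> /=; rewrite -negb_and negbK; exists v.
pose Z := nbr v Z0.
have sZZ : Z \subset Z0 by apply/subsetP => x; rewrite inE => /andP[].
have sZ : Z \subset fib cell e by apply: subset_trans sZZ sZ0.
have cZ : (#|Z0|%:R <= 4 * #|Z|%:R :> R) by rewrite -natrM ler_nat.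
have k0 : 0 < k%:R :> R by rewrite ltr0n.
have [|||||s [z [ss us sF ps [zZ lz]]]] := @path_embed e Z (d :: p) c v (v |: Z0) sZ.
- by rewrite -(ltr_nat R); move: cZ; rewrite cZ0; move: k0; lra.
- by move: cZ; rewrite cZ0; have := et0 e; lra.
- by rewrite /= Gcd.
- move=> d' d'p; have := cap d'; rewrite inE inE d'p !orbT => /(_ isT).
  rewrite [count_mem _ (e :: _)]/= natrD (natrD _ (c == d')) t2.
  have : #|(v |: Z0) :&: fib cell d'|%:R <= (c == d')%:R + ((e == d')%:R + tau * #|fib cell d'|%:R) :> R.
    rewrite setIUl; apply: (@le_trans _ _ (#|[set v] :&: fib cell d'| + #|Z0 :&: fib cell d'|)%:R).
      by rewrite ler_nat leq_card_setU.
    rewrite natrD lerD //.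
      rewrite ler_nat; have [cd'|ncd'] := eqVneq c d'.
        by rewrite (leq_trans (subset_leq_card (subsetIl _ _))) ?cards1.
      rewrite leqn0 cards_eq0; apply/eqP/setP => y; rewrite !inE.
      by apply/andP => -[/eqP->]; move: vc; rewrite in_fib => /eqP->; rewrite (negPf ncd').
    have [ed|ned] := eqVneq e d'.
      by rewrite -ed (setIidPl sZ0) cZ0; move: kg; lra.
    suff -> : Z0 :&: fib cell d' = set0 by rewrite cards0 add0r.
    apply/setP => y; rewrite [in LHS]inE in_set0; apply/andP => -[/(subsetP sZ0)].
    by rewrite !in_fib => /eqP->; rewrite (negPf ned).
  have := t0 d'; rewrite /=; lra.
- suff -> : target (v |: Z0) Z (d :: p) = T by [].
  apply/setP => y; rewrite !inE; case: eqVneq => [->|//] /=.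
  by move: vc; rewrite in_fib => /eqP->; rewrite (negPf ncd) andbF.
exists (z :: v :: s); split; first by rewrite /= ss.
- rewrite /= us andbT inE negb_or -andbA; apply/and3P; split.
  + apply: contraTneq zZ => ->; apply/negP => /(subsetP sZ); rewrite in_fib.
    by move: vc; rewrite in_fib => /eqP->; rewrite (negPf nce).
  + apply/negP => /sF; rewrite !inE (subsetP sZZ) ?orbT //.
  + by apply/negP => /sF; rewrite !inE eqxx.
- rewrite /= rcons_path ps lz !andbT E_sym.
  by move: zZ; rewrite inE => /andP[].
Qed.

End Embedding.

(** * From a connected matching to a cycle, and the alternative of a cover *)

Section MatchingCycle.
Variables (R : archiRealFieldType) (V I : finType) (E : rel V) (cell : V -> I) (G : rel I).
Variables (eps tau : R).
Variables (side : V -> bool) (V0 : {set V}).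
Hypotheses (G_irr : forall c, ~~ G c c) (G_sym : symmetric G) (E_sym : symmetric E).
Hypotheses (eps_gt0 : 0 < eps) (eps_tau : 4 * eps <= tau).
Hypothesis few_poor : forall c d (T : {set V}), G c d -> T \subset fib cell d ->
  eps * #|fib cell d|%:R <= #|T|%:R ->
  #|[set x in fib cell c | ~~ rich E x T]|%:R < eps * #|fib cell c|%:R.
Hypothesis capacity : forall c d, G c d ->
  #|V0 :&: fib cell c|%:R + (2 * #|I|.+1)%:R + 2 * tau * #|fib cell c|%:R <= #|fib cell c|%:R.

(** The ends of [M] are distinct vertices of [V0], so the projected edges use a cell at most
    [#|V0 :&: fib cell c|] times. The joining walk adds [2 * #|I|.+1] visits, and [capacity] leaves
    room for both and for the [2 * tau] of the embedding. *)
Lemma matching_cycle (M : {set V * V}) i0 a :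
    {in M &, injective fst} -> {in M &, injective snd} ->
    (forall p, p \in M -> [/\ p.1 \in V0, p.2 \in V0, side p.1 & ~~ side p.2]) ->
    (forall p, p \in M -> connect G i0 (cell p.1) /\ G (cell p.1) (cell p.2)) ->
    (1 < a)%N -> (#|I| < a)%N -> (a <= #|M|)%N ->
  exists s : seq V, [/\ size s = (2 * a)%N, uniq s & cycle E s].
Proof.
move=> inj1 inj2 MV MG a1 Ia aM.
pose vs := map fst (enum M) ++ map snd (enum M).
have uvs : uniq vs.
  rewrite cat_uniq !map_inj_in_uniq ?enum_uniq //=; try by move=> p q; rewrite !mem_enum; auto.
  rewrite andbT; apply/hasPn => _ /mapP[p pM ->]; apply/mapP => -[q qM Eq].
  move: pM qM; rewrite !mem_enum => /MV[_ _ _ /negP s2] /MV[_ _ s1 _].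
  by apply: s2; rewrite Eq.
have cvs c : (count_mem c (map cell vs) <= #|V0 :&: fib cell c|)%N.
  rewrite count_map -size_filter.
  have /card_uniqP <- : uniq [seq x <- vs | preim cell (pred1 c) x] by rewrite filter_uniq.
  apply: subset_leq_card; apply/subsetP => x; rewrite mem_filter !inE /= => /andP[-> xv].
  rewrite andbT; move: xv; rewrite mem_cat => /orP[]/mapP[p]; rewrite mem_enum => /MV[v1 v2 _ _] ->//.
pose L := map (fun p => (cell p.1, cell p.2)) (enum M).
have [||w [cw sw nw]] := @closed_walk_of_size _ _ G_sym L i0 a _ Ia.
- by move=> _ /mapP[p pM ->]; apply: MG; rewrite mem_enum in pM.
- by rewrite size_map -cardE.
rewrite -sw; apply: (cycle_embed G_irr eps_gt0 eps_tau few_poor E_sym G_sym _ cw).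
  by rewrite sw; move: a1; clear; lia.
move=> d dw; have := capacity (next_cycle cw dw); apply: le_trans.
rewrite lerD2r -natrD ler_nat; apply: leq_trans (nw d) _; rewrite leq_add2r.
apply: leq_trans (cvs d); by rewrite map_cat -!map_comp.
Qed.

End MatchingCycle.

Section CycleOrCover.
Variables (R : archiRealFieldType) (V I : finType) (E : rel V) (cell : V -> I) (G : rel I).
Variables (eps tau : R).
Variables (side : V -> bool) (V0 : {set V}).
Hypotheses (G_irr : forall c, ~~ G c c) (G_sym : symmetric G) (E_sym : symmetric E).
Hypotheses (eps_gt0 : 0 < eps) (eps_tau : 4 * eps <= tau).
Hypothesis few_poor : forall c d (T : {set V}), G c d -> T \subset fib cell d ->
  eps * #|fib cell d|%:R <= #|T|%:R ->
  #|[set x in fib cell c | ~~ rich E x T]|%:R < eps * #|fib cell c|%:R.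
Hypothesis capacity : forall c d, G c d ->
  #|V0 :&: fib cell c|%:R + (2 * #|I|.+1)%:R + 2 * tau * #|fib cell c|%:R <= #|fib cell c|%:R.

(** König's theorem is used in the blow-up of each component, named by its root [u]. A vertex enters
    [C] only through the cover of its own component, so the part of [C] in one component lies in a
    single cover. *)
Lemma cycle_or_cover a : (1 < a)%N -> (#|I| < a)%N ->
  (exists s : seq V, [/\ size s = (2 * a)%N, uniq s & cycle E s]) \/
  exists C : {set V}, (forall u, #|cover_at (fun v => fingraph.root G (cell v)) C u| <= a)%N /\
    forall v w, v \in V0 -> w \in V0 -> side v != side w -> G (cell v) (cell w) ->
      (v \in C) || (w \in C).
Proof.
move=> a1 Ia; have csym := sym_connect_sym G_sym.
pose Eu u : {set V * V} := [set p | [&& p.1 \in V0, p.2 \in V0, side p.1, ~~ side p.2,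
   G (cell p.1) (cell p.2) & fingraph.root G (cell p.1) == u]].
have [/existsP[u /forallP Hu]|/existsPn noM] :=
  boolP [exists u, [forall S, [forall T, covers (Eu u) S T ==> (a <= #|S| + #|T|)%N]]].
  left; have [M [ME i1 i2 aM]] := konig (fun S T => implyP (forallP (Hu S) T)).
  apply: (matching_cycle G_irr G_sym E_sym eps_gt0 eps_tau few_poor capacity
           i1 i2 (i0 := u) (side := side) _ _ a1 Ia aM) => p /(subsetP ME); rewrite inE.
    by case/and5P.
  case/and5P=> _ _ _ _ /andP[Gp /eqP<-]; split=> //.
  by rewrite csym connect_root.
right; have /fin_all_exists[ST STP] u : exists ST : {set V} * {set V},
    covers (Eu u) ST.1 ST.2 && (#|ST.1| + #|ST.2| < a)%N.
  have /forallPn[S /forallPn[T]] := noM u; rewrite negb_imply -ltnNge => h.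
  by exists (S, T).
pose r v := fingraph.root G (cell v).
exists [set v | v \in (ST (r v)).1 :|: (ST (r v)).2]; split=> [u|v w vV wV].
  have /andP[_ /ltnW] := STP u; apply: leq_trans.
  apply: leq_trans (leq_card_setU _ _); apply: subset_leq_card; apply/subsetP => v.
  by rewrite !inE => /andP[h /eqP <-].
wlog sv : v w vV wV / side v => [H|].
  move=> svw Gvw; case sv: (side v); first by apply: H.
  by rewrite orbC; apply: H => //; rewrite 1?eq_sym 1?G_sym //; move: svw; rewrite sv; case: (side w).
rewrite sv => sw Gvw; have /andP[/forall_inP/(_ (v, w)) cov _] := STP (fingraph.root G (cell v)).
have /eqP rvw : r w == r v by rewrite root_connect // csym connect1.
have := cov; rewrite !inE /= -/(r v) vV wV sv Gvw eqxx rvw; move: sw; case: (side w) => // _ /(_ isT).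
by case/orP => ->; rewrite ?orbT.
Qed.
End CycleOrCover.

(** * Properties of dense pairs, and trimming of the cells *)

Section Density.
Variables (R : archiRealFieldType).

Lemma dense_flip (eps : R) (X Y : finType) (e : X -> Y -> bool) A B :
  quarter_dense eps e A B -> quarter_dense eps (fun y x => e x y) B A.
Proof.
move=> /forallP d; apply/forallP => B'; apply/forallP => A'.
have ec : edge_count R (fun y x => e x y) B' A' = edge_count R e A' B'.
  by rewrite /edge_count exchange_big.
have := forallP (d A') B'; rewrite ec [#|B'|%:R * _]mulrC.
by move=> h; do 4![apply/implyP => ?]; move: h; do 4![move=> /implyP -/(_ ltac:(assumption))].
Qed.

Lemma subset_imset_preimset (X X' : finType) (phi : X -> X') (A : {set X}) (A1 : {set X'}) :
  A1 \subset phi @: A -> A1 = phi @: (phi @^-1: A1).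
Proof.
move=> /subsetP sA; apply/setP => z; apply/idP/imsetP => [zA|[x]]; last by rewrite inE => ? ->.
by have /imsetP[x xA zx] := sA z zA; exists x; rewrite // inE -zx.
Qed.

Lemma dense_imset (eps : R) (X Y X' Y' : finType) (e : X -> Y -> bool) (e' : X' -> Y' -> bool)
    (phi : X -> X') (psi : Y -> Y') (A : {set X}) (B : {set Y}) :
    injective phi -> injective psi -> (forall x y, e' (phi x) (psi y) = e x y) ->
  quarter_dense eps e A B -> quarter_dense eps e' (phi @: A) (psi @: B).
Proof.
move=> phiI psiI ee /forallP d; apply/forallP => A1; apply/forallP => B1.
apply/implyP => sA; apply/implyP => sB.
rewrite (subset_imset_preimset sA) (subset_imset_preimset sB) !card_imset //.
have sA' : phi @^-1: A1 \subset A.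
  by apply/subsetP => x; rewrite inE => /(subsetP sA)/imsetP[x' x'A /phiI->].
have sB' : psi @^-1: B1 \subset B.
  by apply/subsetP => y; rewrite inE => /(subsetP sB)/imsetP[y' y'B /psiI->].
have /forallP/(_ (psi @^-1: B1)) := d (phi @^-1: A1); rewrite sA' sB' /=.
congr (_ ==> _ ==> (_ <= _)).
rewrite /edge_count big_imset /=; last by move=> ? ? _ _ /phiI.
apply: eq_bigr => x _; rewrite big_imset /=; last by move=> ? ? _ _ /psiI.
by apply: eq_bigr => y _; rewrite ee.
Qed.

(** Otherwise the poor vertices and [T] form a large subpair of density below 1/4. Poorness is a
    strict inequality between integers, so each poor vertex has one unit to spare; these units add
    up to the term [#|A'|] that makes the contradiction strict. *)
Lemma dense_few_poor (eps : R) (V : finType) (e : rel V) (A B T : {set V}) :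
    0 < eps -> (0 < #|A|)%N -> quarter_dense eps e A B -> T \subset B -> eps * #|B|%:R <= #|T|%:R ->
  #|[set x in A | ~~ rich e x T]|%:R < eps * #|A|%:R.
Proof.
move=> e0 A0 d sT leT; rewrite ltNge; apply/negP => leA.
set A' := [set x in A | _] in leA.
have sA : A' \subset A by apply/subsetP => x; rewrite inE => /andP[].
have := forallP (forallP d A') T; rewrite sA sT leA leT /= => le.
have A'0 : 0 < #|A'|%:R :> R by apply: lt_le_trans leA; rewrite mulr_gt0 // ltr0n.
suff : 4 * edge_count R e A' T + #|A'|%:R <= #|A'|%:R * #|T|%:R :> R by move: le A'0; lra.
rewrite (natr_card _ A') /edge_count mulr_sumr mulr_suml -big_split /=; apply: ler_sum => x.
rewrite inE => /andP[_]; rewrite /rich -ltnNge mul1r => lt.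
suff -> : \sum_(y in T) (e x y)%:R = #|nbr e x T|%:R :> R by rewrite -natrM natr1 ler_nat.
rewrite natr_card big_mkcond [RHS]big_mkcond; apply: eq_bigr => y _.
by rewrite inE; case: (y \in T); case: (e x y).
Qed.

(** Markov's inequality for the row sums. *)
Lemma heavy_rows (tau : R) (X Y : finType) (r : X -> Y -> bool) : 0 < tau -> (0 < #|Y|)%N ->
    \sum_x \sum_y (r x y)%:R <= tau ^+ 2 * (#|X|%:R * #|Y|%:R) ->
  #|[set x | tau * #|Y|%:R < #|[set y | r x y]|%:R]|%:R <= tau * #|X|%:R.
Proof.
move=> t0 Y0 le; set S := [set x | _].
have tY : 0 < tau * #|Y|%:R by rewrite mulr_gt0 // ltr0n.
rewrite -(ler_pM2r tY).
have -> : tau * #|X|%:R * (tau * #|Y|%:R) = tau ^+ 2 * (#|X|%:R * #|Y|%:R) by ring.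
apply: le_trans le; rewrite natr_card mulr_suml big_mkcond; apply: ler_sum => x _.
have -> : \sum_y (r x y)%:R = #|[set y | r x y]|%:R :> R.
  by rewrite natr_card [RHS]big_mkcond; apply: eq_bigr => y _; rewrite inE; case: (r x y).
by rewrite inE; case: ifP => // /ltW; rewrite mul1r.
Qed.

(** Cells smaller than [tau * #|X| / K.+1] are dropped, which loses at most [tau * #|X|] in all. The
    others are cut down to a fraction [1 - 3 * tau], rounded down; the rounding costs at most one
    vertex per cell, hence the term [K]. *)
Lemma thin_large_cells (tau : R) (X J : finType) (f : X -> J) (K : nat) : 0 < tau -> 3 * tau <= 1 ->
    (#|J| <= K)%N ->
  exists X0 : {set X},
  [/\ forall x, x \in X0 -> tau * #|X|%:R <= K.+1%:R * #|fib f (f x)|%:R,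
    forall i, #|X0 :&: fib f i|%:R <= (1 - 3 * tau) * #|fib f i|%:R &
    #|X|%:R <= #|X0|%:R + 4 * tau * #|X|%:R + K%:R].
Proof.
move=> t0 t1 JK.
pose k i := Num.truncn ((1 - 3 * tau) * #|fib f i|%:R).
have n0 i : 0 <= #|fib f i|%:R :> R by [].
have k_le i : (k i)%:R <= (1 - 3 * tau) * #|fib f i|%:R.
  by rewrite truncn_le mulr_ge0 // subr_ge0.
have k_gt i : (1 - 3 * tau) * #|fib f i|%:R < (k i)%:R + 1 by rewrite natr1 truncnS_gt.
have /fin_all_exists[keep keepP] i : exists B : {set X}, B \subset fib f i /\ #|B| = k i.
  have [|B sB cB] := @exists_subset_card _ (fib f i) (k i); last by exists B.
  by rewrite -(ler_nat R); apply: le_trans (k_le i) _; have := n0 i; move: t0; nra.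
pose large i := tau * #|X|%:R <= K.+1%:R * #|fib f i|%:R.
exists [set x | large (f x) && (x \in keep (f x))].
have cI i : #|[set x | large (f x) && (x \in keep (f x))] :&: fib f i| = if large i then k i else 0%N.
  have [sB cB] := keepP i; case: ifP => li.
    rewrite -cB; apply: eq_card => x; rewrite !inE; case: eqVneq => [->|]; first by rewrite li andbT.
    by rewrite andbF => nfx; apply/esym; apply: contraNF nfx => /(subsetP sB); rewrite in_fib.
  apply/eqP; rewrite cards_eq0; apply/eqP/setP => x; rewrite !inE.
  by case: eqVneq => [->|_]; rewrite ?li ?andbF.
split.
- by move=> x; rewrite inE => /andP[].
- by move=> i; rewrite cI; case: ifP => // _; rewrite mulr_ge0 // subr_ge0.
set X0 := finset _ in cI *.
have cX (S : {set X}) : #|S|%:R = \sum_i #|S :&: fib f i|%:R :> R.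
  rewrite natr_card big_mkcond (sum_fib f); apply: eq_bigr => i _.
  rewrite natr_card [RHS]big_mkcond [LHS]big_mkcond; apply: eq_bigr => x _; rewrite in_setI.
  by case: (x \in S); case: (x \in fib f i).
have cT : #|X|%:R = \sum_i #|fib f i|%:R :> R.
  by rewrite -cardsT cX; apply: eq_bigr => i _; rewrite setTI.
have Xs : #|X|%:R * tau / K.+1%:R * #|J|%:R <= tau * #|X|%:R.
  rewrite mulrAC ler_pdivrMr ?ltr0n // [#|X|%:R * _]mulrC; apply: ler_wpM2l.
    by rewrite mulr_ge0 // ltW.
  by rewrite ler_nat leqW.
suff : #|X|%:R <= #|X0|%:R + 3 * tau * #|X|%:R + #|X|%:R * tau / K.+1%:R * #|J|%:R + #|J|%:R.
  have : #|J|%:R <= K%:R :> R by rewrite ler_nat.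
  by move: Xs; set z := _ / _ * _; lra.
have -> : #|J|%:R = \sum_(i : J) 1 :> R by rewrite sumr_const.
rewrite {1 2}cT (cX X0) !mulr_sumr -!big_split /=; apply: ler_sum => i _.
rewrite cI; case: ifP => [_|/negbT]; last rewrite -ltNge.
  have := k_gt i; have : 0 <= #|X|%:R * tau / K.+1%:R by rewrite divr_ge0 ?mulr_ge0 // ltW.
  by set q := _ / _; lra.
rewrite mulrC -ltr_pdivlMr ?ltr0n // [tau * _]mulrC => lt.
by have := mulr_ge0 (ltW t0) (n0 i); move: lt; set q := _ / _; lra.
Qed.

End Density.

(** * Two-coloured complete bipartite graphs *)

Lemma irregular_massE (R : archiRealFieldType) (eps : R) (X Y I : finType) e
    (f : X -> I) (g : Y -> I) :
  irregular_mass eps e f g = \sum_x \sum_y (irregular eps e (fib f (f x)) (fib g (g y)))%:R.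
Proof.
rewrite (sum_fib2 f g) /irregular_mass big_mkcond; apply: eq_bigr => p _.
transitivity (\sum_(x in fib f p.1) \sum_(y in fib g p.2)
   (irregular eps e (fib f p.1) (fib g p.2))%:R : R).
  rewrite !sumr_const; case: ifP => _; last by rewrite mulr0n !mul0rn.
  by rewrite -natrM mulnC mulrnA.
apply: eq_bigr => x; rewrite in_fib => /eqP fx; apply: eq_bigr => y; rewrite in_fib => /eqP gy.
by rewrite fx gy.
Qed.

Section TwoColors.
Variables (R : archiRealFieldType) (X Y J : finType) (f : X -> J) (g : Y -> J).
Variables (N K : nat) (tau : R) (X0 : {set X}) (Y0 : {set Y}).
Hypotheses (cX : #|X| = N) (cY : #|Y| = N) (cJ : (#|J| <= K)%N).
Hypotheses (tau_gt0 : 0 < tau) (tau_le : 4 * tau <= 1).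
Hypothesis N_large : 4 * K.+1%:R * K.+1%:R <= tau ^+ 2 * N%:R.

Let eps : R := tau ^+ 2.

Definition sum_cell (v : X + Y) : J + J :=
  match v with inl x => inl (f x) | inr y => inr (g y) end.
Definition left_side (v : X + Y) := if v is inl _ then true else false.
Definition large_cell (c : J + J) := tau * N%:R <= K.+1%:R * #|fib sum_cell c|%:R.
Definition reduced (e : X -> Y -> bool) (c d : J + J) :=
  [&& bip_rel (fun i j => quarter_dense eps e (fib f i) (fib g j)) c d,
      large_cell c & large_cell d].
Definition sum_set (A : {set X}) (B : {set Y}) : {set X + Y} :=
  [set v | match v with inl x => x \in A | inr y => y \in B end].

Lemma fib_inl i : fib sum_cell (inl i) = inl @: fib f i.
Proof.
apply/setP => -[x|y]; rewrite in_fib /=.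
  by rewrite mem_imset ?in_fib //; apply: inl_inj.
by apply/esym/negbTE/imsetP => -[].
Qed.

Lemma fib_inr j : fib sum_cell (inr j) = inr @: fib g j.
Proof.
apply/setP => -[x|y]; rewrite in_fib /=; last by rewrite mem_imset ?in_fib //; apply: inr_inj.
by apply/esym/negbTE/imsetP => -[].
Qed.

Hypothesis large_X0 : forall x, x \in X0 -> tau * #|X|%:R <= K.+1%:R * #|fib f (f x)|%:R.
Hypothesis large_Y0 : forall y, y \in Y0 -> tau * #|Y|%:R <= K.+1%:R * #|fib g (g y)|%:R.
Hypothesis thin_X0 : forall i, #|X0 :&: fib f i|%:R <= (1 - 3 * tau) * #|fib f i|%:R.
Hypothesis thin_Y0 : forall j, #|Y0 :&: fib g j|%:R <= (1 - 3 * tau) * #|fib g j|%:R.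

Lemma N_gt0 : 0 < N%:R :> R.
Proof.
have t2 : 0 < tau ^+ 2 by rewrite exprn_gt0.
rewrite -(pmulr_rgt0 _ t2); apply: lt_le_trans N_large.
by rewrite !mulr_gt0 ?ltr0n.
Qed.

Lemma large_cell_gt0 c : large_cell c -> (0 < #|fib sum_cell c|)%N.
Proof.
rewrite /large_cell => le; rewrite -(ltr0n R) -(pmulr_rgt0 _ (ltr0Sn R K)).
by apply: lt_le_trans le; rewrite mulr_gt0 ?N_gt0.
Qed.

Lemma color_cycle_or_cover (e : X -> Y -> bool) (A : {set X}) (B : {set Y}) (a : nat) :
    A \subset X0 -> B \subset Y0 -> tau * N%:R <= a%:R ->
  has_cycle (bip_rel e) (2 * a) \/
  exists C : {set X + Y},
    (forall u, #|cover_at (fun v => fingraph.root (reduced e) (sum_cell v)) C u| <= a)%N /\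
    forall v w, v \in sum_set A B -> w \in sum_set A B -> left_side v != left_side w ->
      reduced e (sum_cell v) (sum_cell w) -> (v \in C) || (w \in C).
Proof.
move=> sA sB aN.
have Gsym : symmetric (reduced e).
  by move=> c d; rewrite /reduced bip_rel_sym; congr (_ && _); rewrite andbC.
have t1 : tau ^+ 2 <= tau by rewrite expr2; move: tau_gt0 tau_le => *; nra.
have KN : 4 * K.+1%:R * K.+1%:R <= tau * N%:R.
  by apply: le_trans N_large _; rewrite ler_wpM2r.
have K4 : 4 * K.+1%:R <= tau * N%:R.
  apply: le_trans KN; rewrite -[X in X <= _]mulr1 ler_wpM2l ?mulr_ge0 //.
  by rewrite ler1n.
have cI : (#|{: J + J}| <= 2 * K)%N by rewrite card_sum mul2n -addnn leq_add.
apply: (@cycle_or_cover R _ _ (bip_rel e) sum_cell (reduced e) eps tau left_side).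
- by case=> ?; rewrite /reduced.
- exact: Gsym.
- exact: bip_rel_sym.
- by rewrite exprn_gt0.
- by rewrite /eps expr2; move: tau_gt0 tau_le => *; nra.
- move=> c d T /and3P[den lc ld]; apply: dense_few_poor; first by rewrite exprn_gt0.
    exact: large_cell_gt0.
  case: c d den {lc ld T} => [i|j] [i'|j'] //= den.
    rewrite fib_inl fib_inr; apply: dense_imset den => //; [exact: inl_inj|exact: inr_inj].
  rewrite fib_inl fib_inr; apply: dense_imset (dense_flip den) => //; [exact: inr_inj|exact: inl_inj].
- move=> c d /and3P[_ lc _].
  have thin : #|sum_set A B :&: fib sum_cell c|%:R <= (1 - 3 * tau) * #|fib sum_cell c|%:R.
    case: c {lc} => [i|j].
      rewrite fib_inl card_imset; last exact: inl_inj.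
      apply: le_trans (thin_X0 i); rewrite ler_nat -(card_imset (X0 :&: _) (@inl_inj X Y)).
      apply: subset_leq_card; apply/subsetP => v; rewrite !inE => /andP[vA /imsetP[x xi Ev]].
      by move: vA; rewrite Ev mem_imset ?inE => [/(subsetP sA) ->|]; [rewrite -in_fib xi|apply: inl_inj].
    rewrite fib_inr card_imset; last exact: inr_inj.
    apply: le_trans (thin_Y0 j); rewrite ler_nat -(card_imset (Y0 :&: _) (@inr_inj X Y)).
    apply: subset_leq_card; apply/subsetP => v; rewrite !inE => /andP[vB /imsetP[y yj Ev]].
    by move: vB; rewrite Ev mem_imset ?inE => [/(subsetP sB) ->|]; [rewrite -in_fib yj|apply: inr_inj].
  (* The third [tau] of the trimming: a large cell has at least [tau * N / K.+1] vertices, so by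
     [N_large] a [tau] fraction of it holds the [4 * K.+1] that bounds the overhead of the walk. *)
  have : (2 * #|{: J + J}|.+1)%:R <= tau * #|fib sum_cell c|%:R.
    apply: (@le_trans _ _ (4 * K.+1%:R)).
      by rewrite -natrM ler_nat; move: cI; clear; lia.
    rewrite -(ler_pM2r (ltr0Sn R K)); apply: le_trans N_large _.
    rewrite expr2 -!mulrA ler_pM2l // [_ * K.+1%:R]mulrC //.
  by move: thin; lra.
- rewrite -(ltr_nat R); have : 1 <= K.+1%:R :> R by rewrite ler1n.
  by move: K4 aN; lra.
- rewrite -(ltr_nat R); apply: lt_le_trans aN; apply: lt_le_trans K4.
  by rewrite -natrM ltr_nat; apply: (leq_ltn_trans cI); clear; lia.
Qed.

Lemma two_color_cycle_of_partition (e : X -> Y -> bool) (a b : nat) :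
    irregular_mass eps e f g <= eps * (#|X|%:R * #|Y|%:R) ->
    #|X|%:R <= #|X0|%:R + 4 * tau * #|X|%:R + K%:R ->
    #|Y|%:R <= #|Y0|%:R + 4 * tau * #|Y|%:R + K%:R ->
    tau * N%:R <= a%:R -> tau * N%:R <= b%:R -> a%:R + b%:R + 10 * tau * N%:R <= N%:R ->
  has_cycle (bip_rel e) (2 * a) \/ has_cycle (bip_rel (fun x y => ~~ e x y)) (2 * b).
Proof.
move=> mass lossX lossY aN bN abN.
pose irr x y := irregular eps e (fib f (f x)) (fib g (g y)).
pose badX := [set x | tau * #|Y|%:R < #|[set y | irr x y]|%:R].
pose badY := [set y | tau * #|X|%:R < #|[set x | irr x y]|%:R].
have N0 := N_gt0; have N1 : (0 < N)%N by rewrite -(ltr0n R).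
have cbadX : #|badX|%:R <= tau * #|X|%:R.
  by apply: heavy_rows; rewrite ?cY // -irregular_massE -cY.
have cbadY : #|badY|%:R <= tau * #|Y|%:R.
  apply: heavy_rows; rewrite ?cX //; rewrite exchange_big /= -irregular_massE -cX.
  by rewrite [_ * #|X|%:R]mulrC.
have [|cov1] := @color_cycle_or_cover e _ _ a
   (subsetDl X0 badX) (subsetDl Y0 badY) aN; first by left.
have [|cov2] := @color_cycle_or_cover (fun x y => ~~ e x y) _ _ b
   (subsetDl X0 badX) (subsetDl Y0 badY) bN; first by right.
case: cov1 => C [cC CP]; case: cov2 => D [cD DP]; exfalso.
set V0 := sum_set _ _ in CP DP.
pose beta := Num.truncn (tau * N%:R).
have beta_le : beta%:R <= tau * N%:R by rewrite truncn_le mulr_ge0 // ltW.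
have le_beta n : n%:R <= tau * N%:R -> (n <= beta)%N by rewrite truncn_ge_nat // mulr_ge0 // ltW.
have large v : v \in V0 -> large_cell (sum_cell v).
  rewrite /large_cell inE; case: v => [x|y]; rewrite inE => /andP[_].
    by move=> /large_X0; rewrite cX fib_inl card_imset //; apply: inl_inj.
  by move=> /large_Y0; rewrite cY fib_inr card_imset //; apply: inr_inj.
have csym e' : connect_sym (reduced e').
  by apply: sym_connect_sym => c d; rewrite /reduced bip_rel_sym; congr (_ && _); rewrite andbC.
pose F v := fingraph.root (reduced e) (sum_cell v).
pose G v := fingraph.root (reduced (fun x y => ~~ e x y)) (sum_cell v).
(* Kept vertices lie in large cells. If their pair of cells is not irregular, it is dense in some
   colour, hence an edge of that reduced graph: the two vertices share a component and the cover
   meets one of them. *)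
have cov v w : v \in V0 -> w \in V0 -> left_side w != left_side v ->
    ~~ covered F G C D v w -> bip_rel irr v w.
  move=> vV wV; rewrite eq_sym => s; apply: contraR => nirr.
  have /orP[R1|R2] : reduced e (sum_cell v) (sum_cell w) ||
     reduced (fun x y => ~~ e x y) (sum_cell v) (sum_cell w).
    rewrite /reduced (large v vV) (large w wV) !andbT.
    by case: v w s nirr {vV wV} => [x|y] [x'|y'] //= _; rewrite /irr /irregular negb_and !negbK.
  - apply/orP; left; rewrite (CP v w vV wV s R1) andbT.
    by rewrite root_connect // connect1.
  - apply/orP; right; rewrite (DP v w vV wV s R2) andbT.
    by rewrite root_connect // connect1.
apply: (@no_two_covers _ left_side V0 _ _ F G C D a b beta cC cD).
- move=> [x|y] vV; apply: le_beta.
    have : x \notin badX by move: (vV); rewrite !inE => /andP[].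
    rewrite inE -leNgt cY; apply: le_trans; rewrite ler_nat.
    rewrite -(card_imset _ (@inr_inj X Y)); apply/subset_leq_card/subsetP => w.
    rewrite inE => /and3P[wV s /(cov _ _ vV wV s)]; case: w wV s => // y wV s /= ixy.
    by rewrite mem_imset ?inE //; apply: inr_inj.
  have : y \notin badY by move: (vV); rewrite !inE => /andP[].
  rewrite inE -leNgt cX; apply: le_trans; rewrite ler_nat.
  rewrite -(card_imset _ (@inl_inj X Y)); apply/subset_leq_card/subsetP => w.
  rewrite inE => /and3P[wV s /(cov _ _ vV wV s)]; case: w wV s => // x wV s /= ixy.
  by rewrite mem_imset ?inE //; apply: inl_inj.
- have K1 : 1 <= K.+1%:R :> R by rewrite ler1n.
  have t1 : tau ^+ 2 <= tau by rewrite expr2; move: tau_gt0 tau_le => *; nra.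
  have KN : K%:R <= tau * N%:R.
    apply: (@le_trans _ _ (4 * K.+1%:R * K.+1%:R)).
      by rewrite -!natrM ler_nat; clear; nia.
    by apply: le_trans N_large _; rewrite ler_wpM2r.
  have tN : 0 < tau * N%:R by rewrite mulr_gt0.
  (* In units of [tau * N]: trimming loses at most 4 plus 1 for [K], bad vertices 1, and [2 * beta]
     asks for 2. The 10 granted by [abN] exceed these 8. *)
  have big (T : finType) (S bad : {set T}) n : #|T| = N ->
      #|T|%:R <= #|S|%:R + 4 * tau * #|T|%:R + K%:R -> #|bad|%:R <= tau * #|T|%:R ->
      n = #|S :\: bad| -> (a + b + 2 * beta < n)%N.
    move=> -> le1 le2 ->; rewrite -(ltr_nat R) (natrD _ (a + b)) natrM (natrD _ a b).
    have : #|S|%:R <= #|bad|%:R + #|S :\: bad|%:R :> R.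
      by rewrite -natrD ler_nat -(cardsID bad S) leq_add2r subset_leq_card ?subsetIr.
    by move: tN KN beta_le abN le1 le2; lra.
  case.
  + apply: (big _ X0 badX) => //; rewrite -(card_imset _ (@inl_inj X Y)).
    apply: eq_card => -[x|y]; rewrite inE [in LHS]inE /=.
      by rewrite eqxx andbT mem_imset //; apply: inl_inj.
    by rewrite andbF; apply/esym/negbTE/imsetP => -[].
  + apply: (big _ Y0 badY) => //; rewrite -(card_imset _ (@inr_inj X Y)).
    apply: eq_card => -[x|y]; rewrite inE [in LHS]inE /=.
      by rewrite andbF; apply/esym/negbTE/imsetP => -[].
    by rewrite eqxx andbT mem_imset //; apply: inr_inj.
Qed.

End TwoColors.

Lemma two_color_cycles (R : archiRealFieldType) (kappa : R) : 0 < kappa -> exists N0 : nat,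
  forall (X Y : finType) (N a b : nat) (e : X -> Y -> bool), #|X| = N -> #|Y| = N -> (N0 <= N)%N ->
    kappa * N%:R <= a%:R -> kappa * N%:R <= b%:R -> a%:R + b%:R + kappa * N%:R <= N%:R ->
  has_cycle (bip_rel e) (2 * a) \/ has_cycle (bip_rel (fun x y => ~~ e x y)) (2 * b).
Proof.
move=> k0; pose tau := kappa / 10; have t0 : 0 < tau by rewrite divr_gt0.
have [K reg] := regularity (exprn_gt0 2 t0).
pose n0 : R := 4 * K.+1%:R * K.+1%:R / tau ^+ 2.
exists (Num.truncn n0).+1 => X Y N a b e cX cY N0N aN bN abN.
have tN : 4 * K.+1%:R * K.+1%:R <= tau ^+ 2 * N%:R.
  rewrite [leRHS]mulrC -ler_pdivrMr ?exprn_gt0 //; apply: le_trans (ltW (truncnS_gt n0)) _.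
  by rewrite ler_nat.
have N1 : 0 < N%:R :> R by rewrite ltr0n; apply: leq_trans N0N.
have kN : 10 * (tau * N%:R) = kappa * N%:R by rewrite /tau; field.
have tN0 : 0 < tau * N%:R by rewrite mulr_gt0.
have t1 : 10 * tau <= 1.
  rewrite -(ler_pM2r N1) mul1r -mulrA kN; apply: le_trans abN.
  by rewrite lerDr addr_ge0.
have [J [f [g [cJ mass]]]] := reg X Y e.
have [|X0 [lX tX lossX]] := @thin_large_cells R tau X J f K t0 _ cJ; first by move: t0 t1; lra.
have [|Y0 [lY tY lossY]] := @thin_large_cells R tau Y J g K t0 _ cJ; first by move: t0 t1; lra.
apply: (@two_color_cycle_of_partition R X Y J f g N K tau X0 Y0) => //.
- by move: t0 t1; lra.
- by move: aN tN0 kN; lra.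
- by move: bN tN0 kN; lra.
- by move: abN kN; lra.
Qed.

(** * Asymptotics *)

From mathcomp Require Import all_classical all_reals all_analysis.
Import Order.TTheory GRing.Theory Num.Theory.
Import numFieldNormedType.Exports.
Local Open Scope classical_set_scope.
Local Open Scope ring_scope.

Lemma br_is_bipartite_ramsey (r : nat) (B : 'I_r -> sgraph) (N : nat) :
  arrows (complete_bipartite N N) B -> is_bipartite_ramsey B (br B).
Proof.
move=> arrN; apply: (xgetPex 0%N (P := [set N | is_bipartite_ramsey B N])).
have exN : exists n, `[< arrows (complete_bipartite n n) B >] by exists N; apply/asboolP.
have [m /asboolP arrm minm] := ex_minnP exN.
by exists m; split=> // M arrM; apply: minm; apply/asboolP.
Qed.

Lemma br_cycles_bounds (R : realType) (alpha1 alpha2 d : R) :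
    0 < alpha1 -> 0 < alpha2 -> 0 < d ->
  exists n0 : nat, forall n, (n0 <= n)%N ->
    0 < n%:R :> R /\
    `|(br (pair_family (cycle_graph (2 * Num.truncn (alpha1 * n%:R)))
                       (cycle_graph (2 * Num.truncn (alpha2 * n%:R)))))%:R
      - (alpha1 + alpha2) * n%:R| <= d * n%:R.
Proof.
move=> a1 a2 d0.
have [m [m0 ma1 ma2 md]] : exists m : R, [/\ 0 < m, m <= alpha1, m <= alpha2 & m <= d].
  by exists (Order.min alpha1 (Order.min alpha2 d)); rewrite !lt_min !ge_min !lexx !orbT a1 a2 d0.
pose t := alpha1 + alpha2 + d; have t0 : 0 < t by rewrite !addr_gt0.
(* With [N] the floor of [t * n], this gives [kappa * N <= m * n / 2], half of what [m] guarantees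
   in each of [alpha1 * n], [alpha2 * n] and [d * n]; the other half absorbs the roundings. *)
pose kappa := m / (2 * t); have k0 : 0 < kappa by rewrite divr_gt0 // mulr_gt0.
have [N0 HN0] := two_color_cycles k0.
(* The first term gives [3 < m * n <= d * n]: the lower bound [a + b - 1] loses less than one in
   each floor and one more in the subtraction. The second term gives [N0 <= N]. *)
exists (Num.truncn (3 / m + (N0.+1)%:R / t)).+1 => n n_ge.
have n_gt : 3 / m + N0.+1%:R / t < n%:R.
  by apply: lt_le_trans (truncnS_gt _) _; rewrite ler_nat.
have mn : 3 < m * n%:R.
  rewrite mulrC -ltr_pdivrMr //; apply: le_lt_trans n_gt.
  by rewrite lerDl divr_ge0 // ltW.
have tn : N0.+1%:R < t * n%:R.
  rewrite mulrC -ltr_pdivrMr //; apply: le_lt_trans n_gt.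
  by rewrite lerDr divr_ge0 // ltW.
have n0 : 0 < n%:R :> R.
  by rewrite -(pmulr_rgt0 _ m0); apply: lt_trans mn.
split=> //.
have mul_le (x y : R) : x <= y -> x * n%:R <= y * n%:R by move=> xy; rewrite ler_pM2r.
have := mul_le _ _ ma1; have := mul_le _ _ ma2; have := mul_le _ _ md => h3 h2 h1.
set a := Num.truncn (alpha1 * _); set b := Num.truncn (alpha2 * _).
have trunc_bounds (x : R) : 0 < x -> (Num.truncn x)%:R <= x /\ x < (Num.truncn x)%:R + 1.
  by move=> x0; split; [rewrite truncn_le ltW | rewrite natr1 truncnS_gt].
have [ale age] : a%:R <= alpha1 * n%:R /\ alpha1 * n%:R < a%:R + 1.
  by apply: trunc_bounds; rewrite mulr_gt0.
have [ble bge] : b%:R <= alpha2 * n%:R /\ alpha2 * n%:R < b%:R + 1.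
  by apply: trunc_bounds; rewrite mulr_gt0.
pose N := Num.truncn (t * n%:R).
have [Nle Nge] : N%:R <= t * n%:R /\ t * n%:R < N%:R + 1.
  by apply: trunc_bounds; rewrite mulr_gt0.
have kN : kappa * N%:R <= m * n%:R / 2.
  apply: (@le_trans _ _ (kappa * (t * n%:R))); first by rewrite ler_pM2l.
  rewrite le_eqVlt; apply/orP; left; apply/eqP; rewrite /kappa; field.
  by rewrite gt_eqF.
have tE : t * n%:R = alpha1 * n%:R + alpha2 * n%:R + d * n%:R by rewrite /t !mulrDl.
have arr : arrows (complete_bipartite N N)
    (pair_family (cycle_graph (2 * a)) (cycle_graph (2 * b))).
  apply: arrows_of_two_color_cycles => e; apply: (HN0 _ _ N) => //; rewrite ?card_ord //.
  - by rewrite truncn_ge_nat ?ltW ?mulr_gt0 //; apply: lt_trans tn; rewrite ltr_nat.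
  - lra.
  - lra.
  - lra.
have [arr' /(_ _ arr)] := @br_is_bipartite_ramsey _ _ _ arr.
rewrite -(ler_nat R) => brN.
have ab : (a + b <= (br (pair_family (cycle_graph (2 * a)) (cycle_graph (2 * b)))).+1)%N.
  by apply: arrows_cycles_ge arr'; rewrite -(ltr_nat R); lra.
move: ab; rewrite -(ler_nat R) natrD -natr1 => ab.
by rewrite mulrDl ler_norml; apply/andP; split; lra.
Qed.

Theorem corollary1p2 (R : realType) (alpha1 alpha2 : R) :
  0 < alpha1 -> 0 < alpha2 ->
  exists o : nat -> R,
    o n @[n --> \oo] --> (0 : R) /\
    \forall n \near \oo,
      (br (pair_family (cycle_graph (2 * Num.truncn (alpha1 * n%:R)))
                       (cycle_graph (2 * Num.truncn (alpha2 * n%:R)))))%:R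
      = (alpha1 + alpha2 + o n) * n%:R.
Proof.
move=> a1 a2.
pose B n : R := (br (pair_family (cycle_graph (2 * Num.truncn (alpha1 * n%:R)))
                       (cycle_graph (2 * Num.truncn (alpha2 * n%:R)))))%:R.
exists (fun n => B n / n%:R - (alpha1 + alpha2)); split.
  apply/cvgr0Pnorm_le => d d0; have [n0 H] := br_cycles_bounds a1 a2 d0.
  exists n0 => // n /= /H[n_gt0]; rewrite -/(B n) => Bn.
  rewrite -(ler_pM2r n_gt0) -{2}(gtr0_norm n_gt0) -normrM mulrBl divfK //.
  by rewrite gt_eqF.
(* The error term was defined by division by [n], so the identity is checked from [n = 1] on. *)
exists 1%N => // n /= n1; rewrite -/(B n) addrC subrK divfK //.
by rewrite pnatr_eq0 -lt0n.
Qed.
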